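(* Let $S$ be a bounded self-adjoint operator in a Krein space $(\mathcal H,[\cdot,\cdot])$. Then $S$ is a $J$-frame operator if and only if there exists a fundamental decomposition $\mathcal H=\mathcal K_+\,[\dotplus]\,\mathcal K_-$ such that $S$ admits, with respect to this decomposition, a representation of the form $$S=\begin{bmatrix} A' & LD'\\ -D'L^* & D'\end{bmatrix},$$ where $A'$ is a self-adjoint operator such that $A'+LD'L^*$ is a uniformly positive operator in the Hilbert space $(\mathcal K_+,[\cdot,\cdot])$, $L:\mathcal K_-\to\mathcal K_+$ is a uniform contraction (i.e. $\|L\|<1$), and $D'$ is uniformly positive in the Hilbert space $(\mathcal K_-,-[\cdot,\cdot])$.
   Context: Krein spaces (over $\mathbb C$). A Krein space $(\mathcal H,[\cdot,\cdot])$ is a vector space with a Hermitian sesquilinear form admitting a fundamental decomposition $\mathcal H=\mathcal K_+\,[\dotplus]\,\mathcal K_-$, i.e. a direct, $[\cdot,\cdot]$-orthogonal sum such that $(\mathcal K_+,[\cdot,\cdot])$ and $(\mathcal K_-,-[\cdot,\cdot])$ are Hilbert spaces. The associated Hilbert inner product is $\langle x_++x_-,y_++y_-\rangle=[x_+,y_+]-[x_-,y_-]$; the norms coming from different fundamental decompositions are equivalent, so the topology of $\mathcal H$ is independent of the choice. For Krein spaces $\mathcal H,\mathcal G$ and bounded $T:\mathcal H\to\mathcal G$, $T^+:\mathcal G\to\mathcal H$ is the operator with $[Tx,y]=[x,T^+y]$; $T:\mathcal H\to\mathcal H$ is self-adjoint in the Krein space if $T=T^+$. A subspace $\mathcal L$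 is uniformly positive (negative) if there is $\alpha>0$ with $[x,x]\ge\alpha\|x\|^2$ (resp. $-[x,x]\ge\alpha\|x\|^2$) for all $x\in\mathcal L$; maximal means maximal with respect to inclusion among such subspaces. $J$-frames. A family $\mathcal F=\{f_i\}_{i\in I}$ in $\mathcal H$ is a Bessel family if $\sum_{i\in I}|\langle f,f_i\rangle|^2\le\beta\|f\|^2$ for all $f$, for some $\beta<\infty$. Its synthesis operator is the bounded operator $T:\ell_2(I)\to\mathcal H$, $Tx=\sum_{i\in I}x_if_i$. Put $I_+=\{i:[f_i,f_i]\ge0\}$, $I_-=\{i:[f_i,f_i]<0\}$, and $T_\pm x=\sum_{i\in I_\pm}x_if_i$. $\mathcal F$ is a $J$-frame for $\mathcal H$ if the range $R(T_+)$ is a maximal uniformly positive subspace and $R(T_-)$ is a maximal uniformly negative subspace of $\mathcal H$. The $J$-frame operator of $\mathcal F$ is $Sf=\sum_{i\in I_+}[f,f_i]f_i-\sum_{i\in I_-}[f,f_i]f_i$, $f\in\mathcal H$. An operator $S$ is called a $J$-frame operator if it is the $J$-frame operator of some $J$-frame for $\mathcal H$. Operators. Block operator matrices act on $x_++x_-$ as column vectors and have bounded entries. $L^*:\mathcal K_+\to\mathcal K_-$ is the Hilbert space adjoint of $L$ with respect to the Hilbert spaces $(\mathcal K_-,-[\cdot,\cdot])$ and $(\mathcal K_+,[\cdot,\cdot])$, and $\|L\|$ is the norm with respect to these. Self-adjointness of $A'$ and $D'$ is meant in these Hilbert spaces. A bounded self-adjoint operator in a Hilbert space is uniformly positive if it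 is positive-definite and boundedly invertible. *)

(* Defs.v *)
From HB Require Import structures.
From mathcomp Require Import all_boot all_order all_algebra.
From mathcomp Require Import complex finmap.
From mathcomp Require Import all_classical all_reals all_analysis.
From mathcomp.analysis.showcase Require Import summability.

Set Implicit Arguments.
Unset Strict Implicit.
Unset Printing Implicit Defensive.

Import Order.TTheory GRing.Theory Num.Theory.
Import numFieldNormedType.Exports.

Local Open Scope classical_set_scope.
Local Open Scope ring_scope.
Local Open Scope complex_scope.

(* Linear in the first variable, conjugate-linear in the second one. *)
Notation "{ 'hform' V }" := {hermitian V for false & Num.conj}
  (format "{ 'hform'  V }") : ring_scope.

Definition is_subspace (K : nzRingType) (V : lmodType K) (A : set V) : Prop :=
  submod_closed (mem A).

Record subspace (K : nzRingType) (V : lmodType K) := Subspace {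
  subspace_set : set V;
  subspaceP : is_subspace subspace_set }.

Section SubspaceType.
Variables (K : nzRingType) (V : lmodType K) (U : subspace V).

Definition subspace_pred : {pred V} := mem (subspace_set U).

Fact subspace_pred_closed : submod_closed subspace_pred.
Proof. exact: subspaceP. Qed.

HB.instance Definition _ :=
  GRing.isSubmodClosed.Build K V subspace_pred subspace_pred_closed.

Record subspace_of : Type :=
  SubspaceOf { subspace_val : V; _ : subspace_val \in subspace_pred }.

HB.instance Definition _ := [isSub of subspace_of for subspace_val].
HB.instance Definition _ := [Choice of subspace_of by <:].
HB.instance Definition _ := [SubChoice_isSubZmodule of subspace_of by <:].
HB.instance Definition _ := [SubZmodule_isSubLmodule of subspace_of by <:].
End SubspaceType.

Coercion subspace_of : subspace >-> Sortclass.

Section Forms.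
Variables (R : realType) (V : lmodType R[i]) (f : {hform V}).

Definition opp_form (x y : V) : R[i] := - f x y.

Fact opp_form_bilinear :
  @bilinear_for R[i] V V R[i] *%R (Num.conj \; *%R) opp_form.
Proof.
split=> [y a x x'|x a y y']; rewrite /opp_form.
  by rewrite linearPl /= opprD mulrN.
by rewrite linearPr /= opprD mulrN.
Qed.

Fact opp_form_hermitian x y :
  opp_form x y = (-1) ^+ false * Num.conj (opp_form y x).
Proof. by rewrite /opp_form hermitian_subproof rmorphN mulrN. Qed.

HB.instance Definition _ :=
  bilinear_isBilinear.Build R[i] V V R[i] *%R (Num.conj \; *%R) opp_form
    opp_form_bilinear.
HB.instance Definition _ :=
  isHermitianSesquilinear.Build R[i] V false Num.conj opp_form
    opp_form_hermitian.

Variable U : subspace V.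

Definition sub_form (x y : U) : R[i] := f (val x) (val y).

Fact sub_form_bilinear :
  @bilinear_for R[i] U U R[i] *%R (Num.conj \; *%R) sub_form.
Proof.
split=> [y a x x'|x a y y']; rewrite /sub_form.
  by rewrite [val _]linearP linearPl.
by rewrite [val (_ + _)]linearP linearPr.
Qed.

Fact sub_form_hermitian x y :
  sub_form x y = (-1) ^+ false * Num.conj (sub_form y x).
Proof. exact: hermitian_subproof. Qed.

HB.instance Definition _ :=
  bilinear_isBilinear.Build R[i] U U R[i] *%R (Num.conj \; *%R) sub_form
    sub_form_bilinear.
HB.instance Definition _ :=
  isHermitianSesquilinear.Build R[i] U false Num.conj sub_form
    sub_form_hermitian.
End Forms.
Arguments sub_form {R V} f U x y.

Section InnerProduct.
Variables (R : realType) (V : lmodType R[i]) (ip : V -> V -> R[i]).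

Definition ip_norm (x : V) : R := Num.sqrt (complex.Re (ip x x)).

Definition ip_cauchy (u : nat -> V) : Prop :=
  forall e : R, 0 < e -> \forall m & n \near \oo, ip_norm (u m - u n) < e.

Definition ip_complete : Prop :=
  forall u : nat -> V, ip_cauchy u ->
  exists l : V, (fun n => ip_norm (u n - l)) @ \oo --> (0 : R).

(* Unconditional convergence: the finite partial sums converge along the
   directed set of the finite subsets of I. *)
Definition has_sum (I : choiceType) (g : I -> V) (s : V) : Prop :=
  (fun A : {fset I} => ip_norm (partial_sum g A - s)) @ totally --> (0 : R).

Definition has_sum_on (I : choiceType) (P : pred I) (g : I -> V) : V -> Prop :=
  has_sum (fun i => if P i then g i else 0).
End InnerProduct.

Definition is_hilbert (R : realType) (V : lmodType R[i]) (ip : {hform V}) :=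
  (forall x : V, x != 0 -> 0 < ip x x) /\ ip_complete ip.

Section Operators.
Variables (R : realType) (U V : lmodType R[i]).
Variables (ipU : U -> U -> R[i]) (ipV : V -> V -> R[i]).

Definition op_norm (T : U -> V) : \bar R :=
  ereal_sup [set (ip_norm ipV (T x))%:E | x in [set x | ip_norm ipU x <= 1]].

Definition bounded_op (T : U -> V) : Prop := (op_norm T < +oo)%E.

Definition is_adjoint (T : U -> V) (T' : V -> U) : Prop :=
  forall x y, ipV (T x) y = ipU x (T' y).
End Operators.

Section HilbertOperators.
Variables (R : realType) (V : lmodType R[i]) (ip : V -> V -> R[i]).

Definition self_adjoint (T : V -> V) : Prop := is_adjoint ip ip T T.

Definition boundedly_invertible (T : V -> V) : Prop :=
  exists T' : {linear V -> V},
    [/\ bounded_op ip ip T', cancel T T' & cancel T' T].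

Definition uniformly_positive_op (T : V -> V) : Prop :=
  [/\ bounded_op ip ip T, self_adjoint T,
      forall x, x != 0 -> 0 < ip (T x) x & boundedly_invertible T].
End HilbertOperators.

Section FundamentalDecomposition.
Variables (R : realType) (H : lmodType R[i]) (f : {hform H}).

Record fund_decomp := FundDecomp {
  fd_pos : subspace H;
  fd_neg : subspace H;
  fd_span : forall x, exists (xp : fd_pos) (xm : fd_neg), x = val xp + val xm;
  fd_direct : forall (xp : fd_pos) (xm : fd_neg), val xp = val xm -> val xp = 0;
  fd_orth : forall (xp : fd_pos) (xm : fd_neg), f (val xp) (val xm) = 0;
  fd_pos_hilbert : is_hilbert (sub_form f fd_pos);
  fd_neg_hilbert : is_hilbert (opp_form (sub_form f fd_neg)) }.

Variable K : fund_decomp.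

Definition pos_form : {hform (fd_pos K)} := sub_form f (fd_pos K).
Definition neg_form : {hform (fd_neg K)} := opp_form (sub_form f (fd_neg K)).

(* The components of x; 0 is only a default value for xget, which is never
   used by fd_span. *)
Definition pos_part (x : H) : fd_pos K :=
  xget 0 [set xp | exists xm : fd_neg K, x = val xp + val xm].
Definition neg_part (x : H) : fd_neg K :=
  xget 0 [set xm | exists xp : fd_pos K, x = val xp + val xm].

Definition fund_ip (x y : H) : R[i] :=
  f (val (pos_part x)) (val (pos_part y))
  - f (val (neg_part x)) (val (neg_part y)).

Definition block_op (T : H -> H)
    (A : fd_pos K -> fd_pos K) (B : fd_neg K -> fd_pos K)
    (C : fd_pos K -> fd_neg K) (D : fd_neg K -> fd_neg K) : Prop :=
  forall (xp : fd_pos K) (xm : fd_neg K),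
    T (val xp + val xm) = val (A xp + B xm) + val (C xp + D xm).
End FundamentalDecomposition.

HB.mixin Record isKrein (R : realType) H of GRing.Lmodule R[i] H := {
  krein_form : {hform H};
  krein_decomposable : $| fund_decomp krein_form |
}.

#[short(type="kreinType")]
HB.structure Definition Krein (R : realType) :=
  {H of isKrein R H & GRing.Lmodule R[i] H}.

Section Krein.
Variables (R : realType) (H : kreinType R).
Local Notation "''[' x , y ]" := (krein_form x y).

(* The norm of H comes from a fixed fundamental decomposition. The norms of
   any two decompositions are equivalent, so the notions defined below do not
   depend on the choice. *)
Definition krein_ref : fund_decomp (krein_form : {hform H}) :=
  unsquash krein_decomposable.
Definition krein_ip : H -> H -> R[i] := fund_ip krein_ref.
Definition krein_norm : H -> R := ip_norm krein_ip.

Definition unif_pos_subspace (A : set H) : Prop :=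
  is_subspace A /\ exists2 alpha : R, 0 < alpha &
    forall x, A x -> (alpha * krein_norm x ^+ 2)%:C <= '[x, x].

Definition unif_neg_subspace (A : set H) : Prop :=
  is_subspace A /\ exists2 alpha : R, 0 < alpha &
    forall x, A x -> (alpha * krein_norm x ^+ 2)%:C <= - '[x, x].

Definition maximal_set (P : set H -> Prop) (A : set H) : Prop :=
  P A /\ forall B : set H, P B -> A `<=` B -> B = A.

Section Families.
Variables (I : choiceType) (f : I -> H).

Definition sqr_abs (z : R[i]) : R := complex.Re (`|z| ^+ 2).

Definition ell2 : set (I -> R[i]) :=
  [set x | (\esum_(i in [set: I]) (sqr_abs (x i))%:E < +oo)%E].

Definition bessel_family : Prop :=
  exists beta : R, forall x : H,
    (\esum_(i in [set: I]) (sqr_abs (krein_ip x (f i)))%:E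
       <= (beta * krein_norm x ^+ 2)%:E)%E.

Definition idx_pos : pred I := fun i => 0 <= '[f i, f i].
Definition idx_neg : pred I := fun i => '[f i, f i] < 0.

(* The range of x |-> \sum_(i in P) x i *: f i on l_2(I). *)
Definition synthesis_range (P : pred I) : set H :=
  [set y | exists2 x, ell2 x &
     has_sum_on krein_ip P (fun i => x i *: f i) y].

Definition J_frame : Prop :=
  [/\ bessel_family,
      maximal_set unif_pos_subspace (synthesis_range idx_pos) &
      maximal_set unif_neg_subspace (synthesis_range idx_neg)].

Definition J_frame_operator_of (S : H -> H) : Prop :=
  forall x, exists yp ym : H,
    [/\ has_sum_on krein_ip idx_pos (fun i => '[x, f i] *: f i) yp,
        has_sum_on krein_ip idx_neg (fun i => '[x, f i] *: f i) ym &
        S x = yp - ym].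
End Families.

Definition J_frame_operator (S : H -> H) : Prop :=
  exists (I : choiceType) (f : I -> H), J_frame f /\ J_frame_operator_of f S.
End Krein.

(* Main.v *)
From Pilot Require Import Defs.
From HB Require Import structures.
From mathcomp Require Import all_boot all_order all_algebra.
From mathcomp Require Import complex finmap.
From mathcomp Require Import all_classical all_reals all_analysis.
From mathcomp.analysis.showcase Require Import summability.
From mathcomp Require Import ring lra.
Import Pilot.Defs.

Set Implicit Arguments.
Unset Strict Implicit.
Unset Printing Implicit Defensive.

Import Order.TTheory GRing.Theory Num.Theory.
Import numFieldNormedType.Exports.

Local Open Scope classical_set_scope.
Local Open Scope ring_scope.
Local Open Scope complex_scope.

(** Both directions compare the block matrix with the splitting S = S_+ - S_-,
    where S_+ x and S_- x are the sums of [x, f_i] f_i over I_+ and I_-. Let M_+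
    and M_- be the ranges of the two synthesis operators.

    From a J-frame to the blocks. Since M_+ is maximal uniformly positive,
    K_+ := M_+ and its Krein orthogonal complement K_- form a fundamental
    decomposition (fund_decomp_of_maximal), and the maximal uniformly negative
    M_- is the graph of a uniform contraction L from K_- to K_+
    (graph_operator). As S_+ has its range in K_+ and S_- has its range in the
    graph of L, the components of S x satisfy P_+ S x = S_+ x + L (P_- S x).
    Moreover S_+ vanishes on K_-, so the second column of S is (L D', D'),
    with D' the compression of S to K_-; self-adjointness gives the entry
    - D' L*, and then A' + L D' L* is the restriction of S_+ to K_+. It remains
    to see that this restriction and D' are coercive. Every y in K_+ is a sum
    of c_i f_i over I_+ with c square summable, so that
    2 Re [y, x] <= |c|^2 + [S_+ x, x] (synthesis_bound). Hence the set where
    [S_+ x, x] <= 1 is weakly bounded, thus bounded by the uniform boundedness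
    principle, which is coercivity (coercive_of_weak_bound). The argument for D'
    is the same, because every vector of K_- is the negative part of a vector
    of M_-.

    From the blocks to a J-frame. Put A = A' + L D' L*. The space is the direct
    sum of K_+ and of the graph of L; let Pi be the projection onto K_+ along
    the graph. Writing x = p + (L v + v), the formula
    G(x, x') = <A^-1 p, p'> + <D'^-1 v, v'> defines a Hilbert inner product that
    is equivalent to those of the fundamental decompositions (graph_form), and
    for which Pi is an orthogonal projection. The Gram operator T given by
    G(T x, y) = [x, y] satisfies S = Pi T - (1 - Pi) T. Take a G-orthonormal
    basis E contained in the union of K_+ and the graph (orthonormal_basis).
    The Fourier expansion T x = sum of G(T x, e) e = sum of [x, e] e splits
    under Pi into S_+ x and S_- x, so E is a J-frame with operator S: working
    with the inverses in G makes E a frame with the prescribed operators without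
    any square root.

    The uniform boundedness principle also shows that the norms of any two
    fundamental decompositions are equivalent (fund_norm_equiv). *)

(** * The real part of a Hermitian form *)

Section RealPart.
Variables (R : realType) (V : lmodType R[i]) (ip : {hform V}).
Implicit Types (x y z : V) (a b : R).

(** All estimates use the real part of the form only. It is a real symmetric
    bilinear form, and it determines the complex form by rip_inj. *)
Definition rip x y : R := complex.Re (ip x y).

Lemma ripE x y : rip x y = complex.Re (ip x y). Proof. by []. Qed.

Lemma ip0l x : ip 0 x = 0. Proof. exact: linear0l. Qed.
Lemma ip0r x : ip x 0 = 0. Proof. exact: linear0r. Qed.
Lemma ipDl x y z : ip (x + y) z = ip x z + ip y z. Proof. exact: linearDl. Qed.
Lemma ipDr x y z : ip z (x + y) = ip z x + ip z y. Proof. exact: linearDr. Qed.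
Lemma ipNl x z : ip (- x) z = - ip x z. Proof. exact: linearNl. Qed.
Lemma ipNr x z : ip z (- x) = - ip z x. Proof. exact: linearNr. Qed.
Lemma ipBl x y z : ip (x - y) z = ip x z - ip y z. Proof. exact: linearBl. Qed.
Lemma ipBr x y z : ip z (x - y) = ip z x - ip z y. Proof. exact: linearBr. Qed.
Lemma ipZl (c : R[i]) x z : ip (c *: x) z = c * ip x z.
Proof. exact: linearZl_LR. Qed.
Lemma ipZr (c : R[i]) x z : ip z (c *: x) = Num.conj c * ip z x.
Proof. exact: linearZr_LR. Qed.
Lemma ip_suml (I : Type) (s : seq I) (F : I -> V) z :
  ip (\sum_(i <- s) F i) z = \sum_(i <- s) ip (F i) z.
Proof. exact: linear_sumlz. Qed.
Lemma ip_sumr (I : Type) (s : seq I) (F : I -> V) z :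
  ip z (\sum_(i <- s) F i) = \sum_(i <- s) ip z (F i).
Proof. exact: linear_sumr. Qed.

Lemma ip_conj x y : ip x y = Num.conj (ip y x).
Proof. by rewrite [LHS]hermitian_subproof expr0 mul1r. Qed.

Lemma ReD (z w : R[i]) : complex.Re (z + w) = complex.Re z + complex.Re w.
Proof. by case: z w => [? ?] [? ?]. Qed.
Lemma ReN (z : R[i]) : complex.Re (- z) = - complex.Re z.
Proof. by case: z. Qed.
Lemma ReZ a (z : R[i]) : complex.Re (a%:C * z) = a * complex.Re z.
Proof. by case: z => u v /=; rewrite mul0r subr0. Qed.

Lemma Re_conj (z : R[i]) : complex.Re (Num.conj z) = complex.Re z.
Proof. by case: z. Qed.

Lemma ripC x y : rip x y = rip y x.
Proof. by rewrite /rip ip_conj Re_conj. Qed.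
Lemma ripDl x y z : rip (x + y) z = rip x z + rip y z.
Proof. by rewrite /rip linearDl ReD. Qed.
Lemma ripNl x z : rip (- x) z = - rip x z.
Proof. by rewrite /rip linearNl ReN. Qed.
Lemma ripBl x y z : rip (x - y) z = rip x z - rip y z.
Proof. by rewrite ripDl ripNl. Qed.
Lemma ripZl a x z : rip (a%:C *: x) z = a * rip x z.
Proof. by rewrite /rip linearZl_LR /= ReZ. Qed.
Lemma rip0l x : rip 0 x = 0.
Proof. by rewrite /rip linear0l. Qed.
Lemma ripDr x y z : rip z (x + y) = rip z x + rip z y.
Proof. by rewrite ripC ripDl !(ripC z). Qed.
Lemma ripNr x z : rip z (- x) = - rip z x.
Proof. by rewrite ripC ripNl !(ripC z). Qed.
Lemma ripBr x y z : rip z (x - y) = rip z x - rip z y.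
Proof. by rewrite ripC ripBl !(ripC z). Qed.
Lemma ripZr a x z : rip z (a%:C *: x) = a * rip z x.
Proof. by rewrite ripC ripZl !(ripC z). Qed.
Lemma rip0r x : rip x 0 = 0.
Proof. by rewrite ripC rip0l. Qed.

Lemma ip_self x : ip x x = (rip x x)%:C.
Proof.
have := ip_conj x x; rewrite /rip; case: (ip x x) => u v [] /eqP.
by rewrite -subr_eq0 opprK -mulr2n mulrn_eq0 /= => /eqP ->.
Qed.

Lemma ip_Im x y : complex.Im (ip x y) = rip x ('i *: y).
Proof.
rewrite /rip linearZr_LR /=; case: (ip x y) => u v /=.
by rewrite mul0r mulN1r opprK add0r.
Qed.

(** The imaginary part of ip x y is the real part of ip x ('i *: y), so the
    real parts against all multiples of y determine ip x y. *)
Lemma rip_inj x y z w : (forall c, rip x (c *: y) = rip z (c *: w)) ->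
  ip x y = ip z w.
Proof.
move=> e; apply/eqP; rewrite eq_complex; apply/andP; split; apply/eqP.
  by have := e 1; rewrite !scale1r.
by rewrite !ip_Im e.
Qed.

Definition definite_form := forall x, x != 0 -> 0 < ip x x.

Local Notation N := (ip_norm ip).

Lemma ip_norm_ge0 x : 0 <= N x. Proof. exact: sqrtr_ge0. Qed.
Hint Resolve ip_norm_ge0 : core.

Lemma ip_norm0 : N 0 = 0.
Proof. by rewrite /ip_norm -/(rip _ _) rip0l sqrtr0. Qed.

Lemma ip_normN x : N (- x) = N x.
Proof. by rewrite /ip_norm -!/(rip _ _) ripNl ripNr opprK. Qed.

Lemma ip_normC x y : N (x - y) = N (y - x).
Proof. by rewrite -ip_normN opprB. Qed.

Lemma ip_normZ a x : N (a%:C *: x) = `|a| * N x.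
Proof.
rewrite /ip_norm -!/(rip _ _) ripZl ripZr mulrA -expr2 sqrtrM ?sqr_ge0//.
by rewrite sqrtr_sqr.
Qed.

Lemma ip_normZc (c : R[i]) x : N (c *: x) = complex.Re `|c| * N x.
Proof.
rewrite /ip_norm linearZl_LR linearZr_LR /= mulrA -sqr_normc ip_self normc_def.
rewrite -rmorphXn -rmorphM /= sqrtrM ?sqr_ge0//
  sqrtr_sqr ger0_norm ?sqrtr_ge0//.
by case: (c).
Qed.

Section Definite.
Hypothesis pos : definite_form.

Lemma rip_gt0 x : x != 0 -> 0 < rip x x.
Proof. by move/pos; rewrite ip_self ltcR. Qed.

Lemma rip_ge0 x : 0 <= rip x x.
Proof. by have [->|/rip_gt0/ltW//] := eqVneq x 0; rewrite rip0l. Qed.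
Hint Resolve rip_ge0 : core.

Lemma sqr_ip_norm x : N x ^+ 2 = rip x x.
Proof. exact: sqr_sqrtr (rip_ge0 x). Qed.

Lemma ip_norm_eq0 x : N x = 0 -> x = 0.
Proof.
move=> x0; apply: contrapT => /eqP/rip_gt0.
by rewrite -sqr_ip_norm x0 expr0n ltxx.
Qed.

Lemma ip_norm_gt0 x : x != 0 -> 0 < N x.
Proof.
move=> x0; rewrite lt_def ip_norm_ge0 andbT.
by apply: contra_neq x0 => /ip_norm_eq0.
Qed.

(** Cauchy-Schwarz: expand the square norm of N(y) x - N(x) y. *)
Lemma rip_le x y : rip x y <= N x * N y.
Proof.
have [->|/ip_norm_gt0 x0] := eqVneq x 0; first by rewrite rip0l mulr_ge0.
have [->|/ip_norm_gt0 y0] := eqVneq y 0; first by rewrite rip0r mulr_ge0.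
have := rip_ge0 ((N y)%:C *: x - (N x)%:C *: y).
rewrite !(ripBl, ripBr, ripZl, ripZr) -!sqr_ip_norm (ripC y x).
have := mulr_gt0 x0 y0; nra.
Qed.

Lemma rip_abs_le x y : `|rip x y| <= N x * N y.
Proof.
by rewrite ler_norml rip_le andbT lerNl -ripNl (le_trans (rip_le _ _)) ?ip_normN.
Qed.

Lemma ip_norm_le x a : 0 <= a -> rip x x <= a ^+ 2 -> N x <= a.
Proof. by move=> a0; rewrite -sqr_ip_norm ler_pXn2r ?nnegrE. Qed.

Lemma ip_normD x y : N (x + y) <= N x + N y.
Proof.
apply: ip_norm_le; first exact: addr_ge0.
rewrite !(ripDl, ripDr) (ripC y) sqrrD !sqr_ip_norm; have := rip_le x y; lra.
Qed.

Lemma ip_normB x y z : N (x - z) <= N (x - y) + N (y - z).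
Proof. by rewrite -[x - z](subrKA y) ip_normD. Qed.

Lemma ip_normBD x y : N (x - y) <= N x + N y.
Proof. by rewrite -(ip_normN y) ip_normD. Qed.

Lemma rip_eq x y : (forall z, rip z x = rip z y) -> x = y.
Proof.
move=> e; apply/eqP; rewrite -subr_eq0; apply: contraT => /rip_gt0.
by rewrite ripBr e subrr ltxx.
Qed.

End Definite.
End RealPart.

(** * Lax-Milgram, Riesz and uniform boundedness *)

(** Inverses, adjoints and the operator with a given graph are all obtained
    from a linear relation that is total and functional. *)
Lemma linear_of_rel (K : nzRingType) (U V : lmodType K) (r : U -> V -> Prop) :
  (forall x, exists y, r x y) -> (forall x y z, r x y -> r x z -> y = z) ->
  (forall a x x' y y', r x y -> r x' y' -> r (a *: x + x') (a *: y + y')) ->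
  exists h : {linear U -> V}, forall x, r x (h x).
Proof.
move=> /choice[h hr] ur lr.
have hl : linear h by move=> a x y; apply: ur (hr _) _; exact: lr.
by exists (HB.pack h (GRing.isLinear.Build _ _ _ _ h hl) : {linear U -> V}).
Qed.

(** A quadratic polynomial in t with its minimum at 0 has no linear term. *)
Lemma quad_min (R : realType) (q d : R) : 0 <= q ->
  (forall t, 0 <= t ^+ 2 * q + 2 * t * d) -> d = 0.
Proof.
move=> q0 h; have q1 : 0 < q + 1 by lra.
(* the minimizer would be - d / q; the shift by 1 allows q = 0 *)
have := h (- d / (q + 1)).
have -> : (- d / (q + 1)) ^+ 2 * q + 2 * (- d / (q + 1)) * d
  = - (d ^+ 2 * (q + 2) / (q + 1) ^+ 2) by field; rewrite gt_eqF.
rewrite oppr_ge0 => hd.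
have := sqr_ge0 d.
rewrite le0r => /orP[/eqP/eqP|d0]; first by rewrite sqrf_eq0 => /eqP.
have : 0 < d ^+ 2 * (q + 2) / (q + 1) ^+ 2.
  by rewrite divr_gt0 ?exprn_gt0// mulr_gt0// ltr_wpDl.
by rewrite ltNge hd.
Qed.

Lemma Re_linear_inj (R : realType) (V : lmodType R[i]) (p q : V -> R[i]) :
  (forall a x, p (a *: x) = a * p x) -> (forall a x, q (a *: x) = a * q x) ->
  (forall x, complex.Re (p x) = complex.Re (q x)) -> p =1 q.
Proof.
move=> pl ql e x; apply/eqP; rewrite eq_complex e eqxx /=.
have := e ('i *: x); rewrite pl ql; case: (p x) (q x) => u v [u' v'] /=.
by rewrite !mul0r !mul1r !sub0r => /oppr_inj ->.
Qed.

Section Hilbert.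
Variables (R : realType) (V : lmodType R[i]) (ip : {hform V}).
Hypothesis hilb : is_hilbert ip.
Let pos : definite_form ip := hilb.1.
Local Notation N := (ip_norm ip).
Local Notation rip := (rip ip).
Implicit Types (x y z : V) (a b : R).

(** An explicit modulus of convergence r passes to the limit, and this rate is
    what the iterative constructions below need. *)
Lemma hilbert_limit (u : nat -> V) (r : R ^nat) : r @ \oo --> (0 : R) ->
  (forall m n, (m <= n)%N -> N (u m - u n) <= r m) ->
  exists l, forall n, N (u n - l) <= r n.
Proof.
move=> r0 ur; have [|l ul] := hilb.2 u.
  move=> e e0; have re : \forall n \near \oo, r n < e.
    by apply: (cvgr_lt (0 : R)) => //; exact: r0.
  exists ([set n | r n < e], [set n | r n < e]) => // -[m n] /= [rm rn].
  have [/ur/le_lt_trans->//|/ltnW/ur] := leqP m n.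
  by rewrite ip_normC => /le_lt_trans->.
exists l => n; apply/ler_addgt0Pr => e e0.
have : \forall m \near \oo, N (u m - l) < e.
  by apply: (cvgr_lt (0 : R)) => //; exact: ul.
case=> M _ /(_ (maxn M n)) /= /(_ (leq_maxl _ _)) le_e.
rewrite (le_trans (ip_normB pos _ (u (maxn M n)) _))//.
by rewrite lerD ?(ltW le_e)// ur// leq_maxr.
Qed.

Section LaxMilgram.
Variables (T : {linear V -> V}) (c C B : R) (phi : V -> R).
Hypothesis T_sa : self_adjoint ip T.
Hypothesis c_gt0 : 0 < c.
Hypothesis T_coercive : forall x, c * N x ^+ 2 <= rip (T x) x.
Hypothesis T_bounded : forall x, N (T x) <= C * N x.
Hypothesis phiD : forall x y, phi (x + y) = phi x + phi y.
Hypothesis phiZ : forall a x, phi (a%:C *: x) = a * phi x.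
Hypothesis phi_bounded : forall x, phi x <= B * N x.

Let b x y := rip (T x) y.
Let F x := b x x - 2 * phi x.

Let bC x y : b x y = b y x.
Proof. by rewrite /b ripC !ripE T_sa. Qed.
Let bDl x y z : b (x + y) z = b x z + b y z.
Proof. by rewrite /b linearD ripDl. Qed.
Let bZl a x z : b (a%:C *: x) z = a * b x z.
Proof. by rewrite /b linearZ_LR ripZl. Qed.
Let bDr x y z : b z (x + y) = b z x + b z y.
Proof. by rewrite bC bDl !(bC z). Qed.
Let bZr a x z : b z (a%:C *: x) = a * b z x.
Proof. by rewrite bC bZl !(bC z). Qed.

Let F_line x y t :
  F (x + t%:C *: y) = F x + t ^+ 2 * b y y + 2 * t * (b x y - phi y).
Proof. by rewrite /F !(bDl, bDr, bZl, bZr, phiD, phiZ) (bC y x); ring. Qed.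

Let F_lb x : - (B ^+ 2 / c) <= F x.
Proof.
have := T_coercive x; have := phi_bounded x; rewrite /F -/(b x x).
have h : 0 <= (c * N x - B) ^+ 2 / c by rewrite divr_ge0 ?sqr_ge0 ?ltW.
have e : (c * N x - B) ^+ 2 / c = c * N x ^+ 2 - 2 * B * N x + B ^+ 2 / c.
  by field; rewrite gt_eqF.
by rewrite e in h; lra.
Qed.

(** The energy F x = rip (T x) x - 2 phi x is bounded below. The parallelogram
    identity for rip (T _) _ makes a minimizing sequence Cauchy, and the
    vanishing of the derivative of F at the limit is the claimed identity. For
    T = idfun this represents functionals; for phi = rip z it solves T y = z. *)
Theorem lax_milgram : exists y, forall x, phi x = rip (T x) y.
Proof.
have b_ge0 x : 0 <= b x x.
  by rewrite (le_trans _ (T_coercive x))// mulr_ge0 ?sqr_ge0// ltW.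
have hasF : has_inf (range F).
  split; first by exists (F 0), 0.
  by exists (- (B ^+ 2 / c)) => _ [x _ <-]; exact: F_lb.
pose m := inf (range F).
have mF x : m <= F x by apply: ge_inf; [exact: hasF.2|exists x].
pose r : R ^nat := harmonic.
have r_gt0 n : 0 < r n by exact: harmonic_gt0.
have r0 : r @ \oo --> (0 : R) by exact: cvg_harmonic.
(* F u_n is so close to the infimum that, by the parallelogram identity,
   u_m and u_n are at distance at most 1 / (m + 1) for m <= n *)
have /choice[u uP] n : exists x, F x <= m + c / 4 * r n ^+ 2.
  have [|_ [x _ <-] /ltW] := @inf_adherent _ (range F) (c / 4 * r n ^+ 2) _ hasF.
    by rewrite mulr_gt0 ?exprn_gt0 ?divr_gt0.
  by exists x.
have [||l ul] := @hilbert_limit u r.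
- exact: r0.
- move=> i j ij; apply: (ip_norm_le pos) (ltW (r_gt0 i)) _.
  have rij : r j ^+ 2 <= r i ^+ 2.
    rewrite ler_pXn2r ?nnegrE ?(ltW (r_gt0 _))// /r /harmonic /=.
    by rewrite lef_pV2 ?posrE ?ltr0n// ler_nat.
  pose v := u i - u j.
  have Fj : F (u j) = F (u i) + b v v - 2 * (b (u i) v - phi v).
    have {1}-> : u j = u i + (-1)%:C *: v by rewrite rmorphN scaleN1r opprB subrKC.
    by rewrite F_line; ring.
  have cv := T_coercive v; rewrite -/(b _ _) (sqr_ip_norm pos) in cv.
  (* the midpoint of u i and u j *)
  have mv := mF (u i + (- 2^-1)%:C *: v); rewrite F_line in mv.
  have := uP i; have := uP j; rewrite Fj => Fj' Fi.
  have cc : c / 4 * r j ^+ 2 <= c / 4 * r i ^+ 2.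
    by rewrite ler_wpM2l// divr_ge0// ltW.
  have : c * rip v v <= c * r i ^+ 2 by lra.
  by rewrite ler_pM2l.
have Fl : F l <= m.
  apply/ler_addgt0Pr => e e0.
  pose K := c / 4 + 2 * (`|C| * N l) + 2 * `|B|.
  have K0 : 0 <= K.
    by rewrite !addr_ge0 ?mulr_ge0 ?divr_ge0 ?ip_norm_ge0// ltW.
  have : \forall n \near \oo, r n < e / (K + 1).
    by apply: (cvgr_lt (0 : R)); [exact: r0|rewrite divr_gt0// ltr_wpDl].
  case=> n _ /(_ n) /= /(_ (leqnn _)).
  rewrite ltr_pdivlMr ?ltr_wpDl// => re.
  have r1 : r n <= 1 by rewrite /r /harmonic /= invf_le1 ?ltr0n// ler1n.
  have un := ul n.
  have := uP n; rewrite -[u n](subrK l) addrC -[u n - l]scale1r.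
  rewrite (_ : 1 = 1%:C)// F_line; set v := u n - l.
  have bl : - (b l v) <= `|C| * N l * r n.
    rewrite -ripNl (le_trans (rip_le pos _ _))// ip_normN ler_pM ?ip_norm_ge0//.
    by rewrite (le_trans (T_bounded l))// ler_wpM2r ?ip_norm_ge0// ler_norm.
  have pv : phi v <= `|B| * r n.
    rewrite (le_trans (phi_bounded _))// (@le_trans _ _ (`|B| * N v))//.
      by rewrite ler_wpM2r ?ip_norm_ge0// ler_norm.
    by rewrite ler_wpM2l.
  have := b_ge0 v; have := r_gt0 n => rn0 bv.
  have r2 : c / 4 * r n ^+ 2 <= c / 4 * r n.
    by rewrite ler_wpM2l ?divr_ge0 ?(ltW c_gt0)// expr2 ler_piMl// ltW.
  rewrite /K in re; nra.
exists l => x; apply/esym/eqP; rewrite -subr_eq0; apply/eqP.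
rewrite -/(b x l) bC; apply: (quad_min (b_ge0 x)) => t.
have := mF (l + t%:C *: x); rewrite F_line; move: Fl; lra.
Qed.
End LaxMilgram.

Lemma riesz (phi : V -> R[i]) (B : R) :
  (forall (a : R[i]) x y, phi (a *: x + y) = a * phi x + phi y) ->
  (forall x, complex.Re (phi x) <= B * N x) ->
  exists y, forall x, ip x y = phi x.
Proof.
move=> lin bd.
have phi0 : phi 0 = 0 by have := lin (-1) 0 0; rewrite scaler0 addr0 mulN1r addNr.
have phiZ (a : R[i]) x : phi (a *: x) = a * phi x.
  by rewrite -[_ *: _]addr0 lin phi0 addr0.
have [|||||||y yP] := @lax_milgram idfun 1 1 B (fun x => complex.Re (phi x)).
- by move=> x y.
- exact: ltr01.
- by move=> x; rewrite mul1r sqr_ip_norm.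
- by move=> x; rewrite mul1r.
- by move=> x y; have := lin 1 x y; rewrite scale1r mul1r => ->; rewrite ReD.
- by move=> a x; rewrite phiZ ReZ.
- exact: bd.
exists y; apply: Re_linear_inj.
- by move=> a x; rewrite linearZl_LR.
- exact: phiZ.
- by move=> x; rewrite yP.
Qed.

(** Gliding hump: if A is unbounded, choose a_n in A of norm greater than
    2 n 3^n and add up steps of length 3^-n along +a_n or -a_n. The limit l has
    |rip l a_n| > n for all n, so the products of A with l or with - l are
    unbounded. *)
Lemma uniform_boundedness (A : set V) :
  (forall y, exists C, forall x, A x -> rip x y <= C) ->
  exists C, forall x, A x -> N x <= C.
Proof.
move=> ptw; apply: contrapT => unb.
have /choice[a aP] n : exists x, A x /\ 2 * n%:R * 3 ^+ n < N x.
  apply: contrapT => h; apply: unb; exists (2 * n%:R * 3 ^+ n) => x Ax.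
  by rewrite leNgt; apply/negP => Nx; apply: h; exists x.
(* a step of length 3^-n along a_n, taken in the direction that does not
   decrease the modulus of the product with a_n *)
pose w n := (3 ^- n / N (a n))%:C *: a n.
have a0 n : 0 < N (a n).
  by apply: le_lt_trans (aP n).2; rewrite !mulr_ge0 ?exprn_ge0.
have Nw n : N (w n) = 3 ^- n.
  rewrite ip_normZ ger0_norm ?divr_ge0 ?ip_norm_ge0 ?invr_ge0 ?exprn_ge0//.
  by rewrite divfK// gt_eqF.
pose u := fix u n := if n is m.+1 then
  u m + (if 0 <= rip (u m) (a m) then w m else - w m) else 0.
have uw n : N (u n - u n.+1) = 3 ^- n.
  rewrite /= opprD addNKr ip_normN; case: ifP; rewrite ?ip_normN Nw//.
have wa n : rip (w n) (a n) = 3 ^- n * N (a n).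
  by rewrite ripZl -(sqr_ip_norm pos) expr2 mulrA divfK// gt_eqF.
have ua n : 3 ^- n * N (a n) <= `|rip (u n.+1) (a n)|.
  rewrite /= ripDl; case: ifP => [ge0|/negbT].
    by rewrite wa (le_trans _ (ler_norm _))// lerDr.
  rewrite -ltNge => lt0; rewrite ripNl wa -normrN opprD opprK.
  by rewrite (le_trans _ (ler_norm _))// lerDr oppr_ge0 ltW.
pose r n : R := 3 / 2 * 3 ^- n.
have rS n : r n.+1 + 3 ^- n = r n.
  rewrite /r exprSr; field; rewrite expf_neq0//.
have rE : r = geometric (3 / 2) 3^-1.
  by apply/funext => n; rewrite /r /geometric /= exprVn.
have ur m k : N (u m - u (m + k)%N) <= r m - r (m + k)%N.
  elim: k => [|k IH]; first by rewrite addn0 !subrr ip_norm0.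
  rewrite addnS (le_trans (ip_normB pos _ (u (m + k)%N) _))//.
  by rewrite uw; have := rS (m + k)%N; lra.
have r_ge0 n : 0 <= r n by rewrite mulr_ge0 ?divr_ge0 ?invr_ge0 ?exprn_ge0.
have [||l ul] := @hilbert_limit u r.
- rewrite rE; apply: cvg_geometric; rewrite ger0_norm ?invr_ge0//.
  by rewrite invf_lt1// ltr1n.
- by move=> m n /subnKC <-; rewrite (le_trans (ur _ _))// gerBl.
have [C1 h1] := ptw l; have [C2 h2] := ptw (- l).
pose n := Num.Def.archi_bound (`|C1| + `|C2|).
have nC : `|C1| + `|C2| < n%:R.
  by have := archi_boundP (addr_ge0 (normr_ge0 C1) (normr_ge0 C2)).
have la : `|rip l (a n)| <= `|C1| + `|C2|.
  have [Aa _] := aP n; have := h1 _ Aa; have := h2 _ Aa.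
  rewrite ripNr ripC ler_norml => ? ?.
  have := ler_norm C1; have := ler_norm C2; have := normr_ge0 C1; have := normr_ge0 C2.
  by move=> *; apply/andP; split; lra.
have : n%:R < 3 ^- n * N (a n) / 2.
  rewrite ltr_pdivlMr// ltr_pdivlMl ?exprn_gt0// mulrC [n%:R * _]mulrC.
  by have [_] := aP n.
(* all later steps together change the product with a_n by at most half of
   the amount that the n-th step guarantees *)
have lu : `|rip (u n.+1 - l) (a n)| <= r n.+1 * N (a n).
  by apply: le_trans (rip_abs_le pos _ _) _; rewrite ler_wpM2r ?ip_norm_ge0//; exact: ul.
have rh : r n.+1 = 3 ^- n / 2 by rewrite /r exprSr; field; rewrite expf_neq0.
have : `|rip (u n.+1) (a n)| <= `|rip l (a n)| + `|rip (u n.+1 - l) (a n)|.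
  by rewrite -{1}[u n.+1](subrKC l) ripDl ler_normD.
have := ua n; rewrite rh in lu.
set z := 3 ^- n in lu *; set A' := N (a n) in lu *.
move: lu nC la; lra.
Qed.

(** The unit ball of g is weakly bounded for ip, because |ip x y| is at most
    the g-norm of J y there; hence it is bounded. *)
Lemma gram_norm_bound (g : {hform V}) (J : V -> V) : definite_form g ->
  (forall x y, ip x y = g x (J y)) ->
  exists2 c : R, 0 < c & forall x, N x <= c * ip_norm g x.
Proof.
move=> gpos gJ.
have [|c cP] := @uniform_boundedness [set x | ip_norm g x <= 1].
  move=> y; exists (ip_norm g (J y)) => x /= x1.
  rewrite ripE gJ -ripE (le_trans (rip_le gpos _ _))//.
  by rewrite ler_piMl// ip_norm_ge0.
exists (`|c| + 1) => [|x]; first by rewrite ltr_wpDl.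
have [->|x0] := eqVneq x 0; first by rewrite !ip_norm0 mulr0.
have x2 := ip_norm_gt0 gpos x0.
rewrite -ler_pdivrMr// mulrC -[X in X * _]ger0_norm ?invr_ge0 ?ip_norm_ge0//.
rewrite -ip_normZ (le_trans (cP _ _)) ?(le_trans (ler_norm c)) ?lerDl//=.
by rewrite ip_normZ ger0_norm ?invr_ge0 ?ip_norm_ge0// mulVf// gt_eqF.
Qed.

End Hilbert.

(** * Bounded operators and closed subspaces *)

Section OperatorNorm.
Variables (R : realType) (U V : lmodType R[i]).
Variables (ipU : {hform U}) (ipV : {hform V}).
Hypothesis posU : definite_form ipU.
Variable T : {linear U -> V}.

(** Scaling to the unit ball; a vector of norm 0 is 0 since the form is
    definite. *)
Lemma op_norm_leP (k : R) : 0 <= k ->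
  (op_norm ipU ipV T <= k%:E)%E <->
  forall x, ip_norm ipV (T x) <= k * ip_norm ipU x.
Proof.
move=> k0; split=> [Tk x|Tk]; last first.
  apply: ge_ereal_sup => _ [x /= x1 <-]; rewrite lee_fin (le_trans (Tk x))//.
  by rewrite ler_piMr.
have [->|x0] := eqVneq x 0; first by rewrite linear0 !ip_norm0 mulr0.
have Nx := ip_norm_gt0 posU x0.
rewrite -ler_pdivrMr// mulrC -[X in X * _]ger0_norm ?invr_ge0 ?ip_norm_ge0//.
rewrite -ip_normZ -linearZ_LR -lee_fin; apply: le_trans Tk.
apply: ereal_sup_ubound; eexists; last by [].
by rewrite /= ip_normZ ger0_norm ?invr_ge0 ?ip_norm_ge0// mulVf// gt_eqF.
Qed.

Lemma op_norm_ge0 : (0 <= op_norm ipU ipV T)%E.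
Proof.
apply: ereal_sup_ubound; exists 0; first by rewrite /= ip_norm0.
by rewrite linear0 ip_norm0.
Qed.

Lemma bounded_opP : bounded_op ipU ipV T <->
  exists2 k, 0 <= k & forall x, ip_norm ipV (T x) <= k * ip_norm ipU x.
Proof.
rewrite /bounded_op; split; last first.
  by case=> k k0 /(op_norm_leP k0) /le_lt_trans; apply; exact: ltry.
have := op_norm_ge0; have := op_norm_leP.
case: (op_norm ipU ipV T) => [k kP|_ _|_]; rewrite ?ltxx// lee_fin => k0 _.
by exists k => //; apply/kP.
Qed.

Lemma op_norm_lt1P : (op_norm ipU ipV T < 1)%E <->
  exists k, [/\ 0 <= k, k < 1 & forall x, ip_norm ipV (T x) <= k * ip_norm ipU x].
Proof.
split; last first.
  by case=> k [k0 k1 /(op_norm_leP k0) /le_lt_trans]; apply; rewrite lte_fin.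
have := op_norm_ge0; have := op_norm_leP.
case: (op_norm ipU ipV T) => [k kP|_ _|_]; rewrite ?lee_fin ?lte_fin// => k0 k1.
by exists k; split=> //; apply/kP.
Qed.
End OperatorNorm.

Lemma ip_self_adjoint (R : realType) (V : lmodType R[i]) (ip : {hform V})
  (T : V -> V) x : self_adjoint ip T -> ip (T x) x = (rip ip (T x) x)%:C.
Proof.
move=> sa; have : ip (T x) x = Num.conj (ip (T x) x) by rewrite {1}sa ip_conj.
rewrite /rip; case: (ip (T x) x) => u v [] /eqP.
by rewrite -subr_eq0 opprK -mulr2n mulrn_eq0 /= => /eqP ->.
Qed.

(** Coercivity bounds the inverse by c^-1, and surjectivity is the
    Lax-Milgram theorem for the functionals rip z. *)
Lemma coercive_uniformly_positive (R : realType) (V : lmodType R[i])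
    (ip : {hform V}) (T : {linear V -> V}) (c : R) :
  is_hilbert ip -> self_adjoint ip T -> bounded_op ip ip T -> 0 < c ->
  (forall x, c * ip_norm ip x ^+ 2 <= rip ip (T x) x) ->
  uniformly_positive_op ip T.
Proof.
move=> hilb sa bd c0 coer; have pos : definite_form ip := hilb.1.
have Tpos x : x != 0 -> 0 < rip ip (T x) x.
  move=> x0; apply: lt_le_trans (coer x).
  by rewrite mulr_gt0// exprn_gt0// ip_norm_gt0.
have Tinj x y : T x = T y -> x = y.
  move=> e; apply/eqP; rewrite -subr_eq0; apply: contraT => /Tpos.
  by rewrite linearB e subrr rip0l ltxx.
have [k k0 kP] := (bounded_opP ip pos T).1 bd.
have Tsur z : exists y, T y = z.
  have [|||y yP] := @lax_milgram _ _ _ hilb T c k (ip_norm ip z) (rip ip z) sa c0 coer kP.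
  - by move=> x y; rewrite ripDr.
  - by move=> a x; rewrite ripZr.
  - by move=> x; exact: rip_le.
  exists y; apply: (rip_eq pos) => x.
  by rewrite [RHS]ripC yP /rip sa.
have [||T' T'P] := linear_of_rel Tsur.
- by move=> x y z <- /Tinj.
- by move=> a x x' y y' <- <-; rewrite linearP.
split=> //; first by move=> x x0; rewrite ip_self_adjoint// ltcR Tpos.
exists T'; split; last by [].
  apply/(bounded_opP ip pos); exists c^-1; first by rewrite invr_ge0 ltW.
  move=> x; have [->|/(ip_norm_gt0 pos) T'x] := eqVneq (T' x) 0.
    by rewrite ip_norm0 mulr_ge0 ?invr_ge0 ?ip_norm_ge0// ltW.
  rewrite ler_pdivlMl// -(ler_pM2r T'x) -mulrA -expr2.
  by rewrite (le_trans (coer _))// T'P rip_le.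
by move=> x; apply: Tinj; rewrite T'P.
Qed.

Section Subspaces.
Variables (R : realType) (V : lmodType R[i]).
Implicit Type A : set V.

Lemma is_subspaceP A : is_subspace A <->
  A 0 /\ forall (a : R[i]) x y, A x -> A y -> A (a *: x + y).
Proof.
split=> [[A0 AD]|[A0 AD]]; split.
- by move: A0; rewrite inE.
- move=> a x y Ax Ay; have := AD a x y; rewrite !inE; exact.
- by rewrite inE.
- by move=> a x y; rewrite !inE; exact: AD.
Qed.

Lemma subspace_val_in (U : subspace V) (u : U) : subspace_set U (val u).
Proof. by have := valP u; rewrite inE. Qed.

Lemma subspace_of_in (U : subspace V) x :
  subspace_set U x -> exists u : U, val u = x.
Proof.
move=> Ux; have Ux' : x \in subspace_pred U by rewrite inE.
by exists (SubspaceOf Ux').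
Qed.

Variable ip : {hform V}.
Local Notation N := (ip_norm ip).

Definition ip_closed A :=
  forall x, (forall e : R, 0 < e -> exists2 a, A a & N (x - a) < e) -> A x.

Hypothesis hilb : is_hilbert ip.
Let pos : definite_form ip := hilb.1.

Lemma sub_hilbert (U : subspace V) :
  ip_closed (subspace_set U) -> is_hilbert (sub_form ip U).
Proof.
move=> cU; split=> [x x0|u uc].
  by apply: pos; apply: contra_neq x0 => x0; apply: val_inj; rewrite x0 raddf0.
have [|l ul] := hilb.2 (val \o u).
  move=> e e0; apply: filterS (uc e e0) => -[m n].
  by rewrite /= /ip_norm /sub_form raddfB.
have /subspace_of_in[l' l'E] : subspace_set U l.
  apply: cU => e e0; have : \forall n \near \oo, N (val (u n) - l) < e.
    by apply: (cvgr_lt (0 : R)) => //; exact: ul.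
  by case=> n _ /(_ n) /= /(_ (leqnn _)) ?; exists (val (u n));
    [exact: subspace_val_in|rewrite ip_normC].
exists l'; move: ul; rewrite -l'E /ip_norm /sub_form.
by under [X in X @ _ --> _ -> _]eq_fun do rewrite -raddfB.
Qed.

(** The projection of x represents the functional u |-> ip u x on the Hilbert
    space U. *)
Lemma projection_theorem (U : subspace V) (x : V) :
  ip_closed (subspace_set U) ->
  exists p : U, forall u : U, ip (val u) (x - val p) = 0.
Proof.
move=> cU; have [||p pP] := @riesz _ _ _ (sub_hilbert cU) (fun u => ip (val u) x) (N x).
- by move=> a u v; rewrite linearP linearPl.
- by move=> u; rewrite mulrC; exact: (rip_le pos).
by exists p => u; rewrite linearBr /= -[ip _ (val p)]/(sub_form ip U u p) pP subrr.
Qed.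

End Subspaces.

(** * Unconditional sums *)

#[local] Existing Instance totally_filter.

Section Sums.
Variables (R : realType) (V : lmodType R[i]) (I : choiceType).
Implicit Types (A B : {fset I}).

Lemma partial_sumE (g : I -> V) A : partial_sum g A = \sum_(i <- A) g i.
Proof. by rewrite /partial_sum big_seq_fsetE. Qed.

Lemma esum_fset_leP (a : I -> R) (b : R) : (forall i, 0 <= a i) ->
  (\esum_(i in [set: I]) (a i)%:E <= b%:E)%E <->
  forall A, \sum_(i <- A) a i <= b.
Proof.
move=> a0; split=> [ab A|ab].
  rewrite -lee_fin; apply: le_trans ab; apply: esum_ge.
  exists [set` A]; first by split.
  by rewrite fsbig_finite// set_fsetK sumEFin.
apply: ge_ereal_sup => _ [F [Ff _] <-].
by rewrite fsbig_finite// sumEFin lee_fin.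
Qed.

Lemma esum_fset_ltP (a : I -> R) : (forall i, 0 <= a i) ->
  (\esum_(i in [set: I]) (a i)%:E < +oo)%E <->
  exists b, forall A, \sum_(i <- A) a i <= b.
Proof.
move=> a0; split; last first.
  by case=> b /esum_fset_leP-/(_ a0)/le_lt_trans; apply; exact: ltry.
have := fun b => @esum_fset_leP a b a0.
have : (0 <= \esum_(i in [set: I]) (a i)%:E)%E.
  by apply: esum_ge0 => i _; rewrite lee_fin.
by case: esum => // b _ /(_ b)[/(_ (lexx _)) ? _] _; exists b.
Qed.

Lemma sqr_abs_ge0 (z : R[i]) : 0 <= sqr_abs z.
Proof. by rewrite /sqr_abs -add_Re2_Im2 addr_ge0// sqr_ge0. Qed.

Lemma sqr_absE (z : R[i]) : sqr_abs z = complex.Re (Num.conj z * z).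
Proof.
by rewrite /sqr_abs -add_Re2_Im2 /=; case: z => u v /=; rewrite mulNr opprK !expr2.
Qed.

(** The inequality of arithmetic and geometric means takes the place of
    Cauchy-Schwarz for sums. *)
Lemma Re_mul_le (z w : R[i]) : complex.Re (z * w) <= (sqr_abs z + sqr_abs w) / 2.
Proof.
rewrite /sqr_abs -!add_Re2_Im2 /=; case: z w => u v [u' v'] /=.
have := sqr_ge0 (u - u'); have := sqr_ge0 (v + v'); nra.
Qed.

Variable ip : {hform V}.
Hypothesis pos : definite_form ip.
Local Notation N := (ip_norm ip).

Lemma has_sumP (g : I -> V) s : has_sum ip g s <->
  forall e : R, 0 < e ->
    exists A, forall B, fsubset A B -> N (partial_sum g B - s) < e.
Proof.
split=> [gs e e0|gs].
  have : \forall A \near totally, N (partial_sum g A - s) < e.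
    by apply: (cvgr_lt (0 : R)) => //; exact: gs.
  by case=> A _ AP; exists A => B; exact: AP.
apply/cvgrPdist_lt => e /gs[A AP]; exists A => // B /AP.
by rewrite sub0r normrN ger0_norm// ip_norm_ge0.
Qed.

(** Bounded real functionals commute with unconditional sums. *)
Lemma has_sum_real (g : I -> V) s (psi : V -> R) (b : R) :
  has_sum ip g s -> (forall x y, psi (x + y) = psi x + psi y) ->
  (forall x, psi x <= b * N x) ->
  forall e, 0 < e -> exists A, forall B, fsubset A B ->
    `|\sum_(i <- B) psi (g i) - psi s| < e.
Proof.
move=> /has_sumP gs psiD psib e e0.
have psi0 : psi 0 = 0 by apply: (@addrI _ (psi 0)); rewrite -psiD !addr0.
have psiN x : psi (- x) = - psi x by apply: (@addrI _ (psi x)); rewrite -psiD !subrr.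
have b1 : 0 < `|b| + 1 by rewrite ltr_wpDl.
have [A AP] := gs (e / (`|b| + 1)) (divr_gt0 e0 b1).
exists A => B /AP; rewrite ltr_pdivlMr//; apply: le_lt_trans.
rewrite -(big_morph psi psiD psi0) -partial_sumE -psiN -psiD.
set x := partial_sum g B - s.
have psix y : psi y <= (`|b| + 1) * N y.
  apply: le_trans (psib y) _; rewrite ler_wpM2r ?ip_norm_ge0//.
  by rewrite (le_trans (ler_norm b))// lerDl.
rewrite mulrC ler_norml psix andbT lerNl -psiN.
by rewrite -(ip_normN _ x) psix.
Qed.

Lemma has_sum_le (g : I -> V) s (psi : V -> R) (b c : R) :
  has_sum ip g s -> (forall x y, psi (x + y) = psi x + psi y) ->
  (forall x, psi x <= b * N x) ->
  (forall A, \sum_(i <- A) psi (g i) <= c) -> psi s <= c.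
Proof.
move=> gs psiD psib hc; apply/ler_addgt0Pr => e e0.
have [A /(_ A (fsubset_refl _))] := has_sum_real gs psiD psib e0.
by rewrite ltr_norml => /andP[h _]; have := hc A; lra.
Qed.

Lemma has_sum_ge (g : I -> V) s (psi : V -> R) (b : R) :
  has_sum ip g s -> (forall x y, psi (x + y) = psi x + psi y) ->
  (forall x, psi x <= b * N x) -> (forall i, 0 <= psi (g i)) ->
  forall A, \sum_(i <- A) psi (g i) <= psi s.
Proof.
move=> gs psiD psib g0 B; apply/ler_addgt0Pr => e e0.
have [A /(_ (fsetU A B) (fsubsetUl _ _))] := has_sum_real gs psiD psib e0.
rewrite ltr_norml => /andP[_ h].
have : \sum_(i <- B) psi (g i) <= \sum_(i <- fsetU A B) psi (g i).
  rewrite [leRHS](big_fsetID _ (mem B)) /=.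
  rewrite [X in _ <= X + _](_ : _ = \sum_(i <- B) psi (g i)).
    by rewrite lerDl sumr_ge0.
  congr bigop; congr enum_fset; apply/fsetP => i; rewrite !inE /=.
  by case: (i \in B); rewrite ?orbT ?andbF.
by lra.
Qed.

Lemma has_sum_kernel (W : lmodType R[i]) (ipW : {hform W}) (Q : {linear V -> W})
    (b : R) (g : I -> V) s : definite_form ipW ->
  (forall x, ip_norm ipW (Q x) <= b * N x) ->
  has_sum ip g s -> (forall i, Q (g i) = 0) -> Q s = 0.
Proof.
move=> posW Qb /has_sumP gs Qg; apply: (ip_norm_eq0 posW).
apply/eqP; rewrite eq_le ip_norm_ge0 andbT; apply/ler_addgt0Pr => e e0.
rewrite add0r; have b1 : 0 < `|b| + 1 by rewrite ltr_wpDl.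
have [A /(_ A (fsubset_refl _))] := gs (e / (`|b| + 1)) (divr_gt0 e0 b1).
rewrite ltr_pdivlMr// => /ltW; apply: le_trans.
have -> : Q s = Q (s - partial_sum g A).
  by rewrite linearB partial_sumE linear_sum big1 ?subr0.
rewrite mulrC (le_trans (Qb _))// ip_normC ler_wpM2r ?ip_norm_ge0//.
by rewrite (le_trans (ler_norm b))// lerDl.
Qed.

Lemma has_sum_single (g : I -> V) j :
  (forall i, i != j -> g i = 0) -> has_sum ip g (g j).
Proof.
move=> gj; apply/has_sumP => e e0; exists (fset1 j) => B.
rewrite fsub1set => jB; rewrite partial_sumE (big_fsetD1 j)//=.
rewrite big_seq big1 ?addr0 ?subrr ?ip_norm0// => i.
by rewrite !inE => /andP[/gj].
Qed.

End Sums.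

Lemma has_sum_equiv (R : realType) (V : lmodType R[i]) (I : choiceType)
    (ip1 ip2 : {hform V}) (b : R) (g : I -> V) s :
  (forall x, ip_norm ip1 x <= b * ip_norm ip2 x) ->
  has_sum ip2 g s -> has_sum ip1 g s.
Proof.
move=> le12 /has_sumP gs; apply/has_sumP => e e0.
have b1 : 0 < `|b| + 1 by rewrite ltr_wpDl.
have [A AP] := gs (e / (`|b| + 1)) (divr_gt0 e0 b1).
exists A => B /AP; rewrite ltr_pdivlMr//; apply: le_lt_trans.
rewrite mulrC (le_trans (le12 _))// ler_wpM2r ?ip_norm_ge0//.
by rewrite (le_trans (ler_norm b))// lerDl.
Qed.

(** * Orthonormal bases adapted to a projection *)

Section Orthonormal.
Variables (R : realType) (V : lmodType R[i]) (ip : {hform V}).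
Hypothesis hilb : is_hilbert ip.
Let pos : definite_form ip := hilb.1.
Local Notation N := (ip_norm ip).
Local Notation rip := (rip ip).

Definition orthonormal_set (E : set V) := forall e e' : V, E e -> E e' ->
  ip e e' = (e == e')%:R.

Section Bessel.
Variable E : set V.
Hypothesis E_on : orthonormal_set E.

(** The value 0 outside E lets V itself index the expansion, so that the basis
    needs no index type of its own. *)
Definition fourier (x e : V) : V := if e \in E then ip x e *: e else 0.

Local Notation pr A x := (partial_sum (fourier x) A).
Implicit Types (A B : {fset V}) (x y e : V).

Lemma fourier_in x e : E e -> fourier x e = ip x e *: e.
Proof. by move=> Ee; rewrite /fourier mem_set. Qed.

Lemma fourier_out x e : ~ E e -> fourier x e = 0.
Proof. by move=> Ee; rewrite /fourier memNset. Qed.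

Lemma fourierD x y e : fourier (x + y) e = fourier x e + fourier y e.
Proof. by rewrite /fourier; case: ifP; rewrite ?addr0// ipDl scalerDl. Qed.

Lemma fourierZ a x e : fourier (a *: x) e = a *: fourier x e.
Proof. by rewrite /fourier; case: ifP; rewrite ?scaler0// ipZl scalerA. Qed.

Lemma partial_fourierD A x y : pr A (x + y) = pr A x + pr A y.
Proof.
by rewrite !partial_sumE -big_split; apply: eq_bigr => e _; rewrite fourierD.
Qed.

Lemma partial_fourierZ A a x : pr A (a *: x) = a *: pr A x.
Proof.
by rewrite !partial_sumE scaler_sumr; apply: eq_bigr => e _; rewrite fourierZ.
Qed.

Lemma partial_fourierB A x y : pr A (x - y) = pr A x - pr A y.
Proof. by rewrite partial_fourierD -scaleN1r partial_fourierZ scaleN1r. Qed.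

Lemma partial_fourier_coef A x e : e \in A -> E e -> ip (pr A x) e = ip x e.
Proof.
move=> eA Ee; rewrite partial_sumE ip_suml (big_fsetD1 e)//= /fourier.
rewrite mem_set// ipZl (E_on Ee Ee) eqxx mulr1 big_seq big1 ?addr0// => e'.
rewrite !inE => /andP[/negPf e'e _]; case: ifPn; rewrite ?ip0l// => /set_mem Ee'.
by rewrite ipZl (E_on Ee' Ee) e'e mulr0.
Qed.

(** The error x - pr B x is orthogonal to the part of E in B. *)
Lemma fourier_orth A B x y : fsubset A B -> ip (x - pr B x) (pr A y) = 0.
Proof.
move=> /fsubsetP AB; rewrite [pr A y]partial_sumE ip_sumr big_seq big1// => e /AB eB.
have [Ee|nEe] := pselect (E e); last by rewrite fourier_out// ip0r.
by rewrite fourier_in// ipZr ipBl partial_fourier_coef// subrr mulr0.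
Qed.

(** The error for A is the orthogonal sum of the error for B and of
    pr B x - pr A x. *)
Lemma fourier_best A B x : fsubset A B -> N (x - pr B x) <= N (x - pr A x).
Proof.
move=> AB; apply: (ip_norm_le pos); rewrite ?ip_norm_ge0// (sqr_ip_norm pos).
have -> : x - pr A x = (x - pr B x) + (pr B x - pr A x) by rewrite subrKA.
have : rip (x - pr B x) (pr B x - pr A x) = 0.
  by rewrite ripE ipBr !fourier_orth// subr0.
move: (x - _) (pr B x - _) => u d ud.
by rewrite !(ripDl, ripDr) (ripC _ d) ud addr0 add0r lerDl rip_ge0.
Qed.

Lemma fourier_contraction A x : N (x - pr A x) <= N x.
Proof.
have := @fourier_best fset0 A x (fsub0set _).
by rewrite [pr fset0 x]partial_sumE big_seq_fset0 subr0.
Qed.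

(** The error x - pr A x is orthogonal to pr A x, so its square norm is the
    difference of the two sides. *)
Lemma bessel_inequality A x :
  \sum_(e <- A) (if e \in E then sqr_abs (ip x e) else 0) <= N x ^+ 2.
Proof.
have : 0 <= rip (x - pr A x) x.
  have -> : rip (x - pr A x) x = rip (x - pr A x) (x - pr A x).
    by rewrite [RHS]ripBr [X in _ = _ - X]ripE fourier_orth// subr0.
  exact: rip_ge0.
rewrite (sqr_ip_norm pos) ripBl subr_ge0; apply: le_trans.
rewrite ripC ripE partial_sumE ip_sumr /=.
rewrite (big_morph (@complex.Re R) (@ReD R) (erefl _)) le_eqVlt; apply/orP; left.
apply/eqP; apply: eq_bigr => e _; rewrite /fourier; case: ifP; rewrite ?ip0r//.
by rewrite ipZr sqr_absE.
Qed.
End Bessel.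

Variable P : {linear V -> V}.
Hypothesis P_idem : forall x, P (P x) = P x.
Hypothesis P_sa : self_adjoint ip P.

(** Take by Zorn's lemma a maximal E among the orthonormal sets of eigenvectors
    of P. If the vectors with a Fourier expansion did not fill V, a vector
    orthogonal to all of them would have a nonzero component in the range or in
    the kernel of P that could be added to E. *)
Theorem orthonormal_basis : exists E : set V,
  [/\ orthonormal_set E, forall e, E e -> P e = e \/ P e = 0 &
      forall x, has_sum ip (fourier E x) x].
Proof.
pose adapted (E : set V) := orthonormal_set E /\ forall e, E e -> P e = e \/ P e = 0.
have [F FP Ftot|E [[E_on E_P] Emax]] := @Zorn_bigcup V adapted.
  split=> [e e' [X FX Xe] [Y FY Ye']|e [X FX Xe]]; last exact: (FP X FX).2.
  have [XY|YX] := Ftot X Y FX FY.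
    by apply: (FP Y FY).1 => //; exact: XY.
  by apply: (FP X FX).1 => //; exact: YX.
exists E; split=> //.
(* W is the closed subspace of the vectors that have a Fourier expansion *)
pose W := [set x | forall e : R, 0 < e -> exists A : {fset V},
  N (x - partial_sum (fourier E x) A) < e].
have W_sub : is_subspace W.
  apply/is_subspaceP; split=> [e e0|a x y Wx Wy e e0].
    exists fset0; rewrite partial_sumE big_seq_fset0 subr0 ip_norm0//.
  have a0 : 0 < complex.Re `|a| + 1 by rewrite normc_def /= ltr_wpDl ?sqrtr_ge0.
  have e2 : 0 < e / 2 by rewrite divr_gt0.
  have [A] := Wx _ (divr_gt0 e2 a0); rewrite ltr_pdivlMr// => hA.
  have [B hB] := Wy _ e2; exists (fsetU A B).
  rewrite partial_fourierD partial_fourierZ opprD addrACA -scalerBr.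
  rewrite (le_lt_trans (ip_normD pos _ _))// ip_normZc//.
  have := fourier_best E_on x (fsubsetUl A B).
  have := fourier_best E_on y (fsubsetUr A B).
  set u := N (x - partial_sum _ A) in hA *; set v := N (x - _) => yB xA.
  have : complex.Re `|a| * v <= u * (complex.Re `|a| + 1).
    by rewrite mulrC ler_pM ?ip_norm_ge0 ?lerDl// normc_def sqrtr_ge0.
  by lra.
pose U := Subspace W_sub.
have W_closed : ip_closed ip (subspace_set U).
  move=> x xc e e0; have e2 : 0 < e / 2 by rewrite divr_gt0.
  have [y /(_ _ e2)[A yA] xy] := xc _ e2; exists A.
  have -> : x - partial_sum (fourier E x) A =
    (x - y - partial_sum (fourier E (x - y)) A) + (y - partial_sum (fourier E y) A).
    by rewrite partial_fourierB addrACA -opprD !subrK.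
  rewrite (le_lt_trans (ip_normD pos _ _))// [e]splitr ltrD//.
  exact: le_lt_trans (fourier_contraction E_on _ _) xy.
have WT x : W x; last first.
  move=> x; apply/has_sumP => // e /(WT x e)[A xA]; exists A => B AB.
  by rewrite ip_normC; exact: le_lt_trans (fourier_best E_on x AB) xA.
have [p pP] := projection_theorem hilb x W_closed.
apply: contrapT => nWx; pose z := x - val p.
have z0 : z != 0.
  apply: contra_notN nWx; rewrite subr_eq0 => /eqP ->; exact: (subspace_val_in p).
have Ez e : E e -> ip e z = 0.
  move=> Ee; have /(@subspace_of_in _ _ U)[u <-] : W e; last exact: pP.
  move=> d d0; exists [fset e]%fset; rewrite partial_sumE big_seq_fset1 /fourier.
  by rewrite mem_set// E_on// eqxx scale1r subrr ip_norm0.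
(* z = P z + (z - P z) is orthogonal to E, and so are both summands *)
have [w [w0 Pw Ew]] : exists w, [/\ w != 0, P w = w \/ P w = 0 &
    forall e, E e -> ip e w = 0].
  have [Pz|Pz] := eqVneq (P z) 0; first by exists z; split=> //; right.
  exists (P z); split=> //; first by left.
  by move=> e Ee; rewrite -P_sa; have [->|->] := E_P e Ee; rewrite ?ip0l// Ez.
pose w1 := (N w)^-1%:C *: w.
have Nw := ip_norm_gt0 pos w0.
have w11 : ip w1 w1 = 1.
  rewrite ip_self -(sqr_ip_norm pos) ip_normZ ger0_norm ?invr_ge0 ?ip_norm_ge0//.
  by rewrite mulVf ?expr1n// gt_eqF.
have Ew1 e : E e -> ip e w1 = 0 by move=> Ee; rewrite ipZr Ew// mulr0.
have w1E e : E e -> ip w1 e = 0 by move=> Ee; rewrite ip_conj Ew1// rmorph0.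
have nE : ~ E w1 by move=> /Ew1; rewrite w11 => /eqP; rewrite oner_eq0.
apply: (Emax (w1 |` E)).
  by split; [exact: subsetUr|move=> /(_ w1 (or_introl erefl))].
split=> [e e' [->|Ee] [->|Ee']|e [->|]]; rewrite ?w11 ?eqxx//.
- by rewrite w1E//; case: eqP => // e'w; case: nE; rewrite e'w.
- by rewrite Ew1//; case: eqP => // ew; case: nE; rewrite -ew.
- exact: E_on.
- by rewrite linearZ /=; case: Pw => ->; rewrite ?scaler0; [left|right].
- exact: E_P.
Qed.
End Orthonormal.

(** * Maximal uniform graphs *)

(** Completeness depends only on the norm up to equivalence. *)
Lemma equivalent_hilbert (R : realType) (V : lmodType R[i]) (ip g : {hform V})
    (a b : R) : is_hilbert ip -> definite_form g ->
  (forall x, ip_norm ip x <= a * ip_norm g x) ->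
  (forall x, ip_norm g x <= b * ip_norm ip x) -> is_hilbert g.
Proof.
move=> hilb gpos le_a le_b; split=> // u uc.
have a1 : 0 < `|a| + 1 by rewrite ltr_wpDl.
have [|l ul] := hilb.2 u.
  move=> e e0; apply: filterS (uc _ (divr_gt0 e0 a1)) => -[m n] /=.
  rewrite ltr_pdivlMr// => /(le_lt_trans _); apply.
  rewrite mulrC (le_trans (le_a _))// ler_wpM2r ?ip_norm_ge0//.
  by rewrite (le_trans (ler_norm a))// lerDl.
exists l; apply: (@squeeze_cvgr _ _ _ _ (fun=> 0) (fun n => b * ip_norm ip (u n - l))).
- by near=> n; rewrite ip_norm_ge0 le_b.
- exact: cvg_cst.
- by rewrite -(mulr0 b); apply: cvgMr.
Unshelve. all: by end_near. Qed.

Section UniformGraphs.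
Variables (R : realType) (V : lmodType R[i]) (ip : {hform V}).
Hypothesis hilb : is_hilbert ip.
Let pos : definite_form ip := hilb.1.
Local Notation N := (ip_norm ip).
Local Notation rip := (rip ip).

Variable P : {linear V -> V}.
Hypothesis P_idem : forall x, P (P x) = P x.
Hypothesis P_sa : self_adjoint ip P.

(** The elements of A are dominated by their component in the range of P, so A
    is the graph of a uniform contraction from a subspace of the range of P to
    the kernel of P. For the projections of a fundamental decomposition these
    are the uniformly definite subspaces. *)
Definition uniform_graph (A : set V) := is_subspace A /\
  exists k : R, [/\ 0 <= k, k < 1 & forall x, A x -> N (x - P x) <= k * N (P x)].

(** The ranges of P and of 1 - P are orthogonal, since P is self-adjoint and
    idempotent. *)
Lemma projection_pythagoras x : N x ^+ 2 = N (P x) ^+ 2 + N (x - P x) ^+ 2.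
Proof.
have o : rip (P x) (x - P x) = 0.
  by rewrite ripE P_sa linearB P_idem subrr ip0r.
rewrite -[X in N X ^+ 2 = _](subrKC (P x) x); move: (P x) (x - P x) o => u v o.
by rewrite !(sqr_ip_norm pos) !(ripDl, ripDr) (ripC _ v) o addr0 add0r.
Qed.

Lemma projection_le x : N (P x) <= N x.
Proof.
rewrite -(@ler_pXn2r _ 2)// ?nnegrE ?ip_norm_ge0// (projection_pythagoras x).
by rewrite lerDl sqr_ge0.
Qed.

Lemma projection_compl_le x : N (x - P x) <= N x.
Proof.
rewrite -(@ler_pXn2r _ 2)// ?nnegrE ?ip_norm_ge0// (projection_pythagoras x).
by rewrite lerDr sqr_ge0.
Qed.

Variable A : set V.
Hypothesis A_graph : uniform_graph A.
Hypothesis A_max : forall B, uniform_graph B -> A `<=` B -> B = A.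

(** The defining inequality passes to the closure with the same constant k, so
    the closure is a uniform graph containing A. *)
Lemma maximal_graph_closed : ip_closed ip A.
Proof.
have [/is_subspaceP[A0 AD] [k [k0 k1 Ak]]] := A_graph.
pose B := [set x | forall e : R, 0 < e -> exists2 a, A a & N (x - a) < e].
suff BA : B = A by move=> x xB; rewrite -BA.
apply: A_max; last by move=> x Ax e e0; exists x => //; rewrite subrr ip_norm0.
split.
  apply/is_subspaceP; split=> [e e0|c x y Bx By e e0].
    by exists 0 => //; rewrite subrr ip_norm0.
  have c0 : 0 < complex.Re `|c| + 1 by rewrite normc_def /= ltr_wpDl ?sqrtr_ge0.
  have e2 : 0 < e / 2 by rewrite divr_gt0.
  have [a Aa] := Bx _ (divr_gt0 e2 c0); rewrite ltr_pdivlMr// => xa.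
  have [b Ab yb] := By _ e2; exists (c *: a + b); first exact: AD.
  rewrite opprD addrACA -scalerBr (le_lt_trans (ip_normD pos _ _))// ip_normZc//.
  have := ip_norm_ge0 ip (x - a); move: xa yb.
  by rewrite mulrDr mulr1 mulrC; lra.
exists k; split=> // x Bx; apply/ler_addgt0Pr => e e0.
have [a Aa xa] := Bx _ (divr_gt0 e0 (ltr0Sn R 1)).
have -> : x - P x = (a - P a) + ((x - a) - P (x - a)).
  by rewrite linearB addrACA -opprD !subrKC.
have := ip_normD pos (a - P a) ((x - a) - P (x - a)).
have := projection_compl_le (x - a); have := Ak _ Aa.
have Pa : N (P a) <= N (P x) + N (x - a).
  have -> : P a = P x - P (x - a) by rewrite linearB subKr.
  by rewrite (le_trans (ip_normBD pos _ _))// lerD2l projection_le.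
have := ler_wpM2l k0 Pa; have := ip_norm_ge0 ip (x - a).
have : k * N (x - a) <= N (x - a) by rewrite ler_piMl ?ip_norm_ge0// ltW.
lra.
Qed.

(** On A the norm is controlled by the norm of the P component, so P A is
    complete and hence closed. A vector of the range of P orthogonal to P A
    could be adjoined to A, so by maximality it is 0. *)
Lemma maximal_graph_onto x : P x = x -> exists2 a, A a & P a = x.
Proof.
move=> Px; have [sA [k [k0 k1 Ak]]] := A_graph.
have [A0 AD] := (is_subspaceP A).1 sA.
have AB a b : A a -> A b -> A (a - b).
  by move=> Aa Ab; rewrite addrC -scaleN1r; exact: AD.
have NP a : A a -> N a <= 2 * N (P a).
  move=> /Ak ka; rewrite -{1}(subrKC (P a) a) (le_trans (ip_normD pos _ _))//.
  have : k * N (P a) <= N (P a) by rewrite ler_piMl ?ip_norm_ge0// ltW.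
  by lra.
have sPA : is_subspace [set P a | a in A].
  apply/is_subspaceP; split=> [|c _ _ [a Aa <-] [b Ab <-]].
    by exists 0; rewrite ?linear0.
  by exists (c *: a + b); [exact: AD|rewrite linearP].
pose U := Subspace sPA.
have cU : ip_closed ip (subspace_set U).
  move=> y yP; pose r : R ^nat := harmonic.
  have r_gt0 n : 0 < r n by exact: harmonic_gt0.
  have r0 : r @ \oo --> (0 : R) by exact: cvg_harmonic.
  have /choice[a aP] n : exists a, A a /\ N (y - P a) < r n.
    by have [_ [a Aa <-] ya] := yP _ (r_gt0 n); exists a.
  have [||l al] := @hilbert_limit _ _ _ hilb a (fun n => 4 * r n).
  - by rewrite -(mulr0 4); apply: cvgMr.
  - move=> m n mn; have [Am ym] := aP m; have [An yn] := aP n.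
    rewrite (le_trans (NP _ (AB _ _ Am An)))// linearB.
    have := ip_normB pos (P (a m)) y (P (a n)); rewrite (ip_normC _ _ y).
    have : r n <= r m by rewrite /r /harmonic /= lef_pV2 ?posrE ?ltr0n// ler_nat.
    by lra.
  have lim_le e : 0 < e -> exists n, r n < e.
    move=> e0; have : \forall n \near \oo, r n < e.
      by apply: (cvgr_lt (0 : R)) => //; exact: r0.
    by case=> n _ /(_ n (leqnn _)); exists n.
  have Al : A l.
    apply: maximal_graph_closed => e e0.
    have [n rn] := lim_le (e / 4) (divr_gt0 e0 (ltr0Sn R 3)).
    exists (a n); first exact: (aP n).1.
    by rewrite ip_normC; have := al n; lra.
  exists l => //; apply/eqP; rewrite -subr_eq0; apply/eqP/(ip_norm_eq0 pos).
  apply/eqP; rewrite eq_le ip_norm_ge0 andbT; apply/ler_addgt0Pr => e e0.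
  have [n rn] := lim_le (e / 5) (divr_gt0 e0 (ltr0Sn R 4)).
  have := ip_normB pos (P l) (P (a n)) y; rewrite -linearB.
  have := projection_le (l - a n); rewrite (ip_normC _ l) (ip_normC _ (P (a n)) y).
  by have [_] := aP n; have := al n; lra.
have [p pP] := projection_theorem hilb x cU.
have [a Aa aE] := subspace_val_in p.
pose z := x - P a.
have Pz : P z = z by rewrite linearB Px P_idem.
have zP b : A b -> ip (P b) z = 0.
  move=> Ab; have [u uE] : exists u : U, val u = P b.
    by apply: subspace_of_in; exists b.
  by rewrite -uE /z aE pP.
exists a => //; apply/esym/eqP; rewrite -subr_eq0 -/z; apply: contrapT => /negP z0.
(* adjoining to A a vector z of the range of P that is orthogonal to P A
   keeps the constant k, since it only lengthens the component in that range *)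
pose B := [set y | exists c b, A b /\ y = c *: z + b].
suff Az : A z.
  by have := pos z0; rewrite -{1}Pz zP// ltxx.
suff <- : B = A by exists 1, 0; rewrite scale1r addr0.
apply: A_max; last by move=> b Ab; exists 0, b; rewrite scale0r add0r.
split.
  apply/is_subspaceP; split=> [|c _ _ [d [b [Ab ->]]] [d' [b' [Ab' ->]]]].
    by exists 0, 0; rewrite scale0r addr0.
  exists (c * d + d'), (c *: b + b'); split; first exact: AD.
  by rewrite scalerDr addrACA scalerA scalerDl.
exists k; split=> // _ [c [b [Ab ->]]]; rewrite linearP Pz opprD addrACA subrr add0r.
apply: le_trans (Ak _ Ab) _; rewrite ler_wpM2l//.
apply: (ip_norm_le pos); rewrite ?ip_norm_ge0// (sqr_ip_norm pos).
have o : rip (P b) (c *: z) = 0 by rewrite ripE ipZr zP// mulr0.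
by rewrite ripDl !ripDr (ripC _ (c *: z) (P b)) o addr0 add0r lerDr rip_ge0.
Qed.

End UniformGraphs.

(** * Fundamental decompositions *)

Section FundDecomp.
Variables (R : realType) (H : lmodType R[i]) (f : {hform H}) (K : fund_decomp f).

(** Two decompositions of a vector differ by a common element of the two
    summands. *)
Lemma fund_decomp_uniq (xp yp : fd_pos K) (xm ym : fd_neg K) :
  val xp + val xm = val yp + val ym -> xp = yp /\ xm = ym.
Proof.
move=> e; have e1 : val (xp - yp) = val (ym - xm).
  by rewrite !raddfB; apply/eqP; rewrite subr_eq addrAC -subr_eq opprK e addrC.
have /eqP := fd_direct e1; rewrite raddfB subr_eq0 => /eqP/val_inj xyp.
by split=> //; move: e; rewrite xyp => /addrI/val_inj.
Qed.

Lemma fund_decompK x : val (pos_part K x) + val (neg_part K x) = x.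
Proof.
have [xp [xm xE]] := fd_span K x.
have [ym] : exists xm : fd_neg K, x = val (pos_part K x) + val xm.
  apply: (@xgetPex _ 0 [set yp | exists ym : fd_neg K, x = val yp + val ym]).
  by exists xp, xm.
have [yp] : exists xp : fd_pos K, x = val xp + val (neg_part K x).
  apply: (@xgetPex _ 0 [set ym | exists yp : fd_pos K, x = val yp + val ym]).
  by exists xm, xp.
by move=> e1 e2; have [<- _] := fund_decomp_uniq (etrans (esym e1) e2).
Qed.

Lemma pos_partE (xp : fd_pos K) (xm : fd_neg K) :
  pos_part K (val xp + val xm) = xp.
Proof. by have [] := fund_decomp_uniq (fund_decompK (val xp + val xm)). Qed.

Lemma neg_partE (xp : fd_pos K) (xm : fd_neg K) :
  neg_part K (val xp + val xm) = xm.
Proof. by have [] := fund_decomp_uniq (fund_decompK (val xp + val xm)). Qed.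

Lemma fund_decomp_lin (a : R[i]) x y : a *: x + y =
  val (a *: pos_part K x + pos_part K y) + val (a *: neg_part K x + neg_part K y).
Proof. by rewrite !linearP addrACA -scalerDr !fund_decompK. Qed.

Fact pos_part_linear : linear (pos_part K).
Proof. by move=> a x y; rewrite {1}fund_decomp_lin pos_partE. Qed.
Fact neg_part_linear : linear (neg_part K).
Proof. by move=> a x y; rewrite {1}fund_decomp_lin neg_partE. Qed.

HB.instance Definition _ :=
  GRing.isLinear.Build R[i] H (fd_pos K) *:%R (pos_part K) pos_part_linear.
HB.instance Definition _ :=
  GRing.isLinear.Build R[i] H (fd_neg K) *:%R (neg_part K) neg_part_linear.

Lemma pos_part_val (xp : fd_pos K) : pos_part K (val xp) = xp.
Proof. by have := pos_partE xp 0; rewrite raddf0 addr0. Qed.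
Lemma neg_part_val (xm : fd_neg K) : neg_part K (val xm) = xm.
Proof. by have := neg_partE 0 xm; rewrite raddf0 add0r. Qed.
Lemma pos_part_neg (xm : fd_neg K) : pos_part K (val xm) = 0.
Proof. by have := pos_partE 0 xm; rewrite raddf0 add0r. Qed.
Lemma neg_part_pos (xp : fd_pos K) : neg_part K (val xp) = 0.
Proof. by have := neg_partE xp 0; rewrite raddf0 addr0. Qed.

Lemma fund_ipE x y : fund_ip K x y =
  pos_form K (pos_part K x) (pos_part K y) + neg_form K (neg_part K x) (neg_part K y).
Proof. by []. Qed.

Fact fund_ip_bilinear :
  @bilinear_for R[i] H H R[i] *%R (Num.conj \; *%R) (fund_ip K).
Proof.
split=> [y a x x'|x a y y']; rewrite !fund_ipE !(pos_part_linear, neg_part_linear).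
  by rewrite !ipDl !ipZl addrACA -mulrDr.
by rewrite !ipDr !ipZr addrACA -mulrDr.
Qed.

Fact fund_ip_hermitian x y :
  fund_ip K x y = (-1) ^+ false * Num.conj (fund_ip K y x).
Proof.
rewrite !fund_ipE expr0 mul1r [in LHS]ip_conj [X in _ + X = _]ip_conj.
by rewrite -rmorphD.
Qed.

HB.instance Definition _ :=
  bilinear_isBilinear.Build R[i] H H R[i] *%R (Num.conj \; *%R) (fund_ip K)
    fund_ip_bilinear.
HB.instance Definition _ :=
  isHermitianSesquilinear.Build R[i] H false Num.conj (fund_ip K)
    fund_ip_hermitian.

Lemma form_decomp x y : f x y =
  pos_form K (pos_part K x) (pos_part K y) - neg_form K (neg_part K x) (neg_part K y).
Proof.
rewrite -{1}(fund_decompK x) -{1}(fund_decompK y) ipDl !ipDr fd_orth.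
by rewrite (ip_conj f (val (neg_part K x))) fd_orth rmorph0 addr0 add0r opprK.
Qed.

Local Notation N := (ip_norm (fund_ip K)).
Local Notation Np := (ip_norm (pos_form K)).
Local Notation Nn := (ip_norm (neg_form K)).

Definition pos_pos : definite_form (pos_form K) := (fd_pos_hilbert K).1.
Definition neg_pos : definite_form (neg_form K) := (fd_neg_hilbert K).1.

Lemma fund_pos : definite_form (fund_ip K).
Proof.
move=> x x0; rewrite -[ltRHS]/(fund_ip K x x) fund_ipE.
have [p0|p0] := eqVneq (pos_part K x) 0; last first.
  rewrite ltr_pwDl//; first exact: pos_pos.
  by rewrite ip_self lecR rip_ge0//; exact: neg_pos.
rewrite p0 ip0l add0r neg_pos//; apply: contra_neq x0 => n0.
by rewrite -(fund_decompK x) p0 n0 !raddf0 addr0.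
Qed.

Lemma fund_norm_sqr x : N x ^+ 2 = Np (pos_part K x) ^+ 2 + Nn (neg_part K x) ^+ 2.
Proof.
rewrite (sqr_ip_norm fund_pos) (sqr_ip_norm pos_pos) (sqr_ip_norm neg_pos).
by rewrite !ripE -ReD.
Qed.

Lemma form_norm_sqr x : rip f x x = Np (pos_part K x) ^+ 2 - Nn (neg_part K x) ^+ 2.
Proof.
rewrite (sqr_ip_norm pos_pos) (sqr_ip_norm neg_pos) !ripE.
by rewrite form_decomp ReD ReN.
Qed.

Lemma pos_part_le x : Np (pos_part K x) <= N x.
Proof.
rewrite -(@ler_pXn2r _ 2)// ?nnegrE ?ip_norm_ge0//.
by rewrite fund_norm_sqr lerDl sqr_ge0.
Qed.

Lemma neg_part_le x : Nn (neg_part K x) <= N x.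
Proof.
rewrite -(@ler_pXn2r _ 2)// ?nnegrE ?ip_norm_ge0//.
by rewrite fund_norm_sqr lerDr sqr_ge0.
Qed.

Lemma fund_norm_pos (xp : fd_pos K) : N (val xp) = Np xp.
Proof.
by rewrite /ip_norm fund_ipE pos_part_val neg_part_pos ip0l addr0.
Qed.

Lemma fund_norm_neg (xm : fd_neg K) : N (val xm) = Nn xm.
Proof.
by rewrite /ip_norm fund_ipE pos_part_neg neg_part_val ip0l add0r.
Qed.

Lemma fund_norm_le x : N x <= Np (pos_part K x) + Nn (neg_part K x).
Proof.
rewrite -{1}(fund_decompK x) (le_trans (ip_normD fund_pos _ _))//.
by rewrite fund_norm_pos fund_norm_neg.
Qed.

Lemma fund_hilbert : is_hilbert (fund_ip K).
Proof.
split=> [|u uc]; first exact: fund_pos.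
have [|lp ulp] := (fd_pos_hilbert K).2 (pos_part K \o u).
  move=> e e0; apply: filterS (uc _ e0) => -[m n] /=; apply: le_lt_trans.
  by rewrite -raddfB pos_part_le.
have [|lm ulm] := (fd_neg_hilbert K).2 (neg_part K \o u).
  move=> e e0; apply: filterS (uc _ e0) => -[m n] /=; apply: le_lt_trans.
  by rewrite -raddfB neg_part_le.
exists (val lp + val lm).
apply: (@squeeze_cvgr _ _ _ _ (fun=> 0) (fun n =>
  Np (pos_part K (u n) - lp) + Nn (neg_part K (u n) - lm))).
- near=> n; rewrite ip_norm_ge0 (le_trans (fund_norm_le _))//.
  by rewrite !raddfB /= pos_partE neg_partE.
- exact: cvg_cst.
- by rewrite -[X in _ --> X](addr0 0); exact: cvgD ulp ulm.
Unshelve. all: by end_near. Qed.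

Definition pos_proj (x : H) : H := val (pos_part K x).
Definition neg_proj (x : H) : H := val (neg_part K x).

Fact pos_proj_linear : linear pos_proj.
Proof. by move=> a x y; rewrite /pos_proj !linearP. Qed.
Fact neg_proj_linear : linear neg_proj.
Proof. by move=> a x y; rewrite /neg_proj !linearP. Qed.

HB.instance Definition _ :=
  GRing.isLinear.Build R[i] H H *:%R pos_proj pos_proj_linear.
HB.instance Definition _ :=
  GRing.isLinear.Build R[i] H H *:%R neg_proj neg_proj_linear.

Lemma pos_proj_idem x : pos_proj (pos_proj x) = pos_proj x.
Proof. by rewrite /pos_proj pos_part_val. Qed.
Lemma neg_proj_idem x : neg_proj (neg_proj x) = neg_proj x.
Proof. by rewrite /neg_proj neg_part_val. Qed.

Lemma pos_proj_sa : self_adjoint (fund_ip K) pos_proj.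
Proof.
move=> x y; rewrite !fund_ipE /pos_proj !pos_part_val !neg_part_pos.
by rewrite ip0l ip0r.
Qed.
Lemma neg_proj_sa : self_adjoint (fund_ip K) neg_proj.
Proof.
move=> x y; rewrite !fund_ipE /neg_proj !neg_part_val !pos_part_neg.
by rewrite ip0l ip0r.
Qed.

Lemma pos_proj_compl x : x - pos_proj x = neg_proj x.
Proof. by rewrite -{1}(fund_decompK x) addrC addKr. Qed.
Lemma neg_proj_compl x : x - neg_proj x = pos_proj x.
Proof. by rewrite -{1}(fund_decompK x) addrK. Qed.

(** The fundamental symmetry, which turns the Krein form into the Hilbert
    inner product and back. *)
Definition fund_sym x := pos_proj x - neg_proj x.

Lemma pos_part_sym x : pos_part K (fund_sym x) = pos_part K x.
Proof. by rewrite raddfB /= pos_part_val pos_part_neg subr0. Qed.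
Lemma neg_part_sym x : neg_part K (fund_sym x) = - neg_part K x.
Proof. by rewrite raddfB /= neg_part_val neg_part_pos sub0r. Qed.

Lemma form_fund x y : f x y = fund_ip K x (fund_sym y).
Proof. by rewrite fund_ipE pos_part_sym neg_part_sym ipNr form_decomp. Qed.

Lemma fund_norm_sym x : N (fund_sym x) = N x.
Proof.
have h y : N y = Num.sqrt (Np (pos_part K y) ^+ 2 + Nn (neg_part K y) ^+ 2).
  by rewrite -fund_norm_sqr sqrtr_sqr ger0_norm ?ip_norm_ge0.
by rewrite !h pos_part_sym neg_part_sym ip_normN.
Qed.

Lemma form_le x y : rip f x y <= N x * N y.
Proof.
have -> : rip f x y = rip (fund_ip K) x (fund_sym y).
  by rewrite ripE form_fund.
rewrite (le_trans (rip_le fund_pos _ _))//.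
by rewrite fund_norm_sym.
Qed.

Lemma fund_form x y : fund_ip K x y = f x (fund_sym y).
Proof.
rewrite form_decomp pos_part_sym neg_part_sym ipNr opprK.
exact: fund_ipE.
Qed.

End FundDecomp.

(** By the two fundamental symmetries, the first inner product is a Gram form of
    the second one. *)
Lemma fund_norm_equiv (R : realType) (H : lmodType R[i]) (f : {hform H})
    (K1 K2 : fund_decomp f) :
  exists2 c : R, 0 < c & forall x,
    ip_norm (fund_ip K1) x <= c * ip_norm (fund_ip K2) x.
Proof.
apply: (gram_norm_bound (fund_hilbert K1) (J := fun y =>
  fund_sym K2 (fund_sym K1 y))) => [|x y]; first exact: fund_pos.
by rewrite [LHS]fund_form [LHS](form_fund K2).
Qed.

(** * Adjoints, coercivity and restricted forms *)

Lemma ip_eq (R : realType) (V : lmodType R[i]) (ip : {hform V}) x y :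
  definite_form ip -> (forall z, ip z x = ip z y) -> x = y.
Proof. by move=> pos e; apply: (rip_eq pos) => z; rewrite !ripE e. Qed.

(** The vector T' y represents the functional x |-> ipV (T x) y. *)
Lemma exists_adjoint (R : realType) (U V : lmodType R[i]) (ipU : {hform U})
    (ipV : {hform V}) (T : {linear U -> V}) (k : R) :
  is_hilbert ipU -> definite_form ipV -> 0 <= k ->
  (forall x, ip_norm ipV (T x) <= k * ip_norm ipU x) ->
  exists T' : {linear V -> U}, is_adjoint ipU ipV T T' /\
    forall y, ip_norm ipU (T' y) <= k * ip_norm ipV y.
Proof.
move=> hU posV k0 Tk; have posU : definite_form ipU := hU.1.
have ex y : exists w, forall x, ipU x w = ipV (T x) y.
  apply: (riesz hU (B := k * ip_norm ipV y)) => [a x x'|x].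
    by rewrite linearP ipDl ipZl.
  by rewrite -ripE (le_trans (rip_le posV _ _))// mulrAC ler_wpM2r ?ip_norm_ge0.
have [||T' T'P] := linear_of_rel ex.
- by move=> y w w' e e'; apply: (ip_eq posU) => z; rewrite e e'.
- by move=> a y y' w w' e e' x; rewrite !ipDr !ipZr e e'.
exists T'; split=> [x y|y]; first by rewrite [RHS]T'P.
have [->|/(ip_norm_gt0 posU) T'y] := eqVneq (T' y) 0.
  by rewrite ip_norm0 mulr_ge0 ?ip_norm_ge0.
rewrite -(ler_pM2r T'y) -expr2 (sqr_ip_norm posU) [leLHS]ripE T'P -ripE.
by rewrite (le_trans (rip_le posV _ _))// mulrAC ler_wpM2r ?ip_norm_ge0.
Qed.

(** The sublevel set of the quadratic form is weakly bounded, hence bounded by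
    some B; by homogeneity the quadratic form dominates B^-2 times the square
    norm. *)
Lemma coercive_of_weak_bound (R : realType) (V : lmodType R[i]) (ip : {hform V})
    (T : {linear V -> V}) : is_hilbert ip ->
  (forall x, 0 <= rip ip (T x) x) ->
  (forall y, exists C : R, forall x, rip ip (T x) x <= 1 -> rip ip x y <= C) ->
  exists2 c : R, 0 < c & forall x, c * ip_norm ip x ^+ 2 <= rip ip (T x) x.
Proof.
move=> hilb T0 weak.
have [|b bP] := @uniform_boundedness _ _ _ hilb [set x | rip ip (T x) x <= 1].
  by move=> y; have [C CP] := weak y; exists C.
pose B := `|b| + 1; have B0 : 0 < B by rewrite ltr_wpDl.
have B2 : 0 < B ^+ 2 by rewrite exprn_gt0.
exists (B ^- 2) => [|x]; first by rewrite invr_gt0.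
rewrite mulrC ler_pdivrMr//; apply/ler_addgt0Pr => e e0.
set q := rip ip (T x) x.
have d0 : 0 < e / B ^+ 2 by rewrite divr_gt0.
have qd : 0 < q + e / B ^+ 2 by rewrite ltr_wpDl ?T0.
(* the perturbation by e covers the vectors x with q = 0 *)
pose t := Num.sqrt (q + e / B ^+ 2).
have t0 : 0 < t by rewrite sqrtr_gt0.
have t2 : t ^+ 2 = q + e / B ^+ 2 by rewrite sqr_sqrtr// ltW.
have : ip_norm ip (t^-1%:C *: x) <= B.
  rewrite (@le_trans _ _ b) ?(le_trans (ler_norm b)) ?lerDl// bP//=.
  rewrite linearZ_LR ripZl ripZr mulrA -invfM -expr2 t2 mulrC ler_pdivrMr//.
  by rewrite mul1r lerDl ltW.
rewrite ip_normZ ger0_norm ?invr_ge0 ?(ltW t0)// mulrC ler_pdivrMr// => h.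
have : ip_norm ip x ^+ 2 <= (B * t) ^+ 2.
  by rewrite ler_pXn2r ?nnegrE ?ip_norm_ge0// mulr_ge0 ?(ltW B0) ?(ltW t0).
by rewrite exprMn t2 mulrDr mulrCA divff ?gt_eqF// mulr1 mulrC.
Qed.

Lemma le_of_sqr_le (R : realType) (c a b : R) : 0 < c -> 0 <= a -> 0 <= b ->
  c * a ^+ 2 <= b ^+ 2 -> a <= Num.sqrt c^-1 * b.
Proof.
move=> c0 a0 b0 cab.
rewrite -(@ler_pXn2r _ 2)// ?nnegrE ?mulr_ge0 ?sqrtr_ge0//.
by rewrite exprMn sqr_sqrtr ?invr_ge0 ?(ltW c0)// ler_pdivlMl.
Qed.

(** With p and q the square norms of P x and x - P x, the inequality
    a (p + q) <= p - q gives q <= p / (1 + a), and q <= k^2 p gives back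
    p - q >= (1 - k^2) / 2 * (p + q). Only the constants change when the norm
    is replaced by an equivalent one. *)
Lemma uniform_graph_equiv (R : realType) (V : lmodType R[i]) (ip : {hform V})
    (P : {linear V -> V}) (N0 : V -> R) (c1 c2 : R) (A : set V) :
  is_hilbert ip -> (forall x, P (P x) = P x) -> self_adjoint ip P ->
  0 < c1 -> 0 < c2 -> (forall x, 0 <= N0 x) ->
  (forall x, N0 x <= c1 * ip_norm ip x) ->
  (forall x, ip_norm ip x <= c2 * N0 x) ->
  (is_subspace A /\ exists2 alpha : R, 0 < alpha & forall x, A x ->
     alpha * N0 x ^+ 2 <= ip_norm ip (P x) ^+ 2 - ip_norm ip (x - P x) ^+ 2) <->
  uniform_graph ip P A.
Proof.
move=> hilb idem sa c10 c20 N00 le1 le2; set N := ip_norm ip.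
split=> -[sA]; last first.
  case=> k [k0 k1 kP]; split=> //; exists ((1 - k ^+ 2) / 2 / c1 ^+ 2).
    by rewrite !divr_gt0 ?exprn_gt0// subr_gt0 expr_lt1.
  move=> x /kP kx; have N2 : N0 x ^+ 2 <= c1 ^+ 2 * N x ^+ 2.
    by rewrite -exprMn ler_pXn2r ?nnegrE ?N00 ?mulr_ge0 ?ip_norm_ge0 ?(ltW c10).
  have k2 : N (x - P x) ^+ 2 <= k ^+ 2 * N (P x) ^+ 2.
    by rewrite -exprMn ler_pXn2r ?nnegrE ?mulr_ge0 ?ip_norm_ge0.
  have kk : 0 < 1 - k ^+ 2 by rewrite subr_gt0 expr_lt1.
  rewrite mulrAC ler_pdivrMr ?exprn_gt0//.
  rewrite (@le_trans _ _ ((1 - k ^+ 2) / 2 * (c1 ^+ 2 * N x ^+ 2)))//.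
    by rewrite ler_wpM2l// divr_ge0// ltW.
  rewrite mulrCA mulrC ler_wpM2r ?sqr_ge0//.
  rewrite /N (projection_pythagoras hilb idem sa) -/N.
  have := ler_wpM2l (ltW kk) k2; have := sqr_ge0 (N (P x)).
  move: k2 kk; set p := N (P x) ^+ 2; set q := N (x - P x) ^+ 2.
  set K := k ^+ 2 => k2 kk p0 h; have := mulr_ge0 (sqr_ge0 (1 - K)) p0.
  nra.
case=> al al0 alP; split=> //; pose a := al / c2 ^+ 2.
have a0 : 0 < a by rewrite divr_gt0 ?exprn_gt0.
have a1 : 0 < 1 + a by rewrite ltr_wpDr// ltW.
exists (Num.sqrt (1 + a)^-1); split=> [||x Ax]; first exact: sqrtr_ge0.
  by rewrite -[ltRHS]sqrtr1 ltr_sqrt// invf_lt1// ltrDl.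
apply: le_of_sqr_le; rewrite ?ip_norm_ge0//.
have := alP _ Ax.
have : a * N x ^+ 2 <= al * N0 x ^+ 2.
  rewrite mulrAC ler_pdivrMr ?exprn_gt0// -mulrA ler_wpM2l ?(ltW al0)//.
  by rewrite mulrC -exprMn ler_pXn2r ?nnegrE ?mulr_ge0 ?ip_norm_ge0 ?(ltW c20).
rewrite /N (projection_pythagoras hilb idem sa x) -/N.
have := mulr_ge0 (ltW a0) (sqr_ge0 (N (P x))); nra.
Qed.

(** On U the form g is squeezed between multiples of the square of the
    complete norm. *)
Lemma sub_hilbert_equiv (R : realType) (V : lmodType R[i]) (ip g : {hform V})
    (U : subspace V) (c : R) : is_hilbert ip -> ip_closed ip (subspace_set U) ->
  0 < c ->
  (forall x, subspace_set U x -> c * ip_norm ip x ^+ 2 <= rip g x x) ->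
  (forall x, rip g x x <= ip_norm ip x ^+ 2) ->
  is_hilbert (sub_form g U).
Proof.
move=> hilb cU c0 lb ub; have pos : definite_form ip := hilb.1.
have g_pos : definite_form (sub_form g U).
  move=> u u0; rewrite -[ltRHS]/(g (val u) (val u)) ip_self ltcR.
  apply: lt_le_trans (lb _ (subspace_val_in u)); rewrite mulr_gt0// exprn_gt0//.
  apply: (ip_norm_gt0 pos); apply: contra_neq u0 => u0; apply: val_inj.
  by rewrite u0 raddf0.
apply: (@equivalent_hilbert _ _ (sub_form ip U) _ (Num.sqrt c^-1) 1) => //.
- exact: sub_hilbert.
- move=> u; apply: le_of_sqr_le; rewrite ?ip_norm_ge0// (sqr_ip_norm g_pos).
  exact: lb (subspace_val_in u).
- move=> u; rewrite mul1r; apply: (ip_norm_le g_pos); rewrite ?ip_norm_ge0//.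
  exact: ub.
Qed.

(** * Uniformly definite subspaces of a Krein space *)

Lemma rip_opp (R : realType) (V : lmodType R[i]) (ip : {hform V}) x y :
  rip (opp_form ip) x y = - rip ip x y.
Proof. exact: ReN. Qed.

Section Krein.
Variables (R : realType) (H : kreinType R).
Local Notation f := (krein_form : {hform H}).
Local Notation N0 := (ip_norm (fund_ip (@krein_ref R H))).

Lemma krein_normE x : krein_norm x = N0 x. Proof. by []. Qed.

(** The Krein form at x is the difference of the square norms of the two
    components of x, in any fundamental decomposition. *)
Lemma unif_pos_subspaceP (K : fund_decomp f) (A : set H) :
  unif_pos_subspace A <-> uniform_graph (fund_ip K) (pos_proj K) A.
Proof.
have [c1 c10 le1] := fund_norm_equiv (@krein_ref R H) K.
have [c2 c20 le2] := fund_norm_equiv K (@krein_ref R H).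
apply: iff_trans (uniform_graph_equiv A (fund_hilbert K) (pos_proj_idem K)
  (pos_proj_sa K) c10 c20 (fun x => ip_norm_ge0 _ x) le1 le2).
have e x (al : R) : ((al * krein_norm x ^+ 2)%:C <= f x x) = (al * N0 x ^+ 2 <=
    ip_norm (fund_ip K) (pos_proj K x) ^+ 2
    - ip_norm (fund_ip K) (x - pos_proj K x) ^+ 2).
  rewrite ip_self lecR (form_norm_sqr K) pos_proj_compl.
  by rewrite fund_norm_pos fund_norm_neg krein_normE.
by split=> -[sA [al al0 alP]]; split=> //; exists al => // x /alP; rewrite e.
Qed.

Lemma unif_neg_subspaceP (K : fund_decomp f) (A : set H) :
  unif_neg_subspace A <-> uniform_graph (fund_ip K) (neg_proj K) A.
Proof.
have [c1 c10 le1] := fund_norm_equiv (@krein_ref R H) K.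
have [c2 c20 le2] := fund_norm_equiv K (@krein_ref R H).
apply: iff_trans (uniform_graph_equiv A (fund_hilbert K) (neg_proj_idem K)
  (neg_proj_sa K) c10 c20 (fun x => ip_norm_ge0 _ x) le1 le2).
have e x (al : R) : ((al * krein_norm x ^+ 2)%:C <= - f x x) = (al * N0 x ^+ 2 <=
    ip_norm (fund_ip K) (neg_proj K x) ^+ 2
    - ip_norm (fund_ip K) (x - neg_proj K x) ^+ 2).
  rewrite ip_self -rmorphN lecR (form_norm_sqr K) neg_proj_compl opprB.
  by rewrite fund_norm_pos fund_norm_neg krein_normE.
by split=> -[sA [al al0 alP]]; split=> //; exists al => // x /alP; rewrite e.
Qed.

(** The decomposition consists of A and its Krein orthogonal complement B. The
    Krein form makes A a Hilbert space, so representing x |-> [_, x] on A splits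
    off the component of x in A. Maximality makes the projection of A onto the
    positive subspace of the reference decomposition surjective, which forces B
    to be uniformly negative. *)
Lemma fund_decomp_of_maximal (A : set H) : maximal_set (@unif_pos_subspace R H) A ->
  exists K : fund_decomp f, subspace_set (fd_pos K) = A.
Proof.
move=> [Apos Amax]; pose K0 := @krein_ref R H.
have hilb := fund_hilbert K0.
have Ag := (unif_pos_subspaceP K0 A).1 Apos.
have Agmax B : uniform_graph (fund_ip K0) (pos_proj K0) B -> A `<=` B -> B = A.
  by move=> /unif_pos_subspaceP; exact: Amax.
have cA := maximal_graph_closed hilb (pos_proj_idem K0) (pos_proj_sa K0) Ag Agmax.
have ontoA := maximal_graph_onto hilb (pos_proj_idem K0) (pos_proj_sa K0) Ag Agmax.
have [sA [k [k0 k1 kP]]] := Ag.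
have [_ [al al0 alP]] := Apos.
pose Up := Subspace sA.
have lbp x : A x -> al * N0 x ^+ 2 <= rip f x x.
  by move=> /alP; rewrite ip_self lecR.
have ub (x : H) : `|rip f x x| <= N0 x ^+ 2.
  rewrite (form_norm_sqr K0) (fund_norm_sqr K0).
  rewrite ler_norml; have := sqr_ge0 (ip_norm (pos_form K0) (pos_part K0 x)).
  have := sqr_ge0 (ip_norm (neg_form K0) (neg_part K0 x)).
  by move=> *; apply/andP; split; lra.
have hUp : is_hilbert (sub_form f Up).
  apply: (@sub_hilbert_equiv _ _ _ f Up al hilb cA al0 lbp) => x.
  by rewrite (le_trans (ler_norm _))// ub.
pose B := [set y : H | forall a, A a -> f a y = 0].
have sB : is_subspace B.
  apply/is_subspaceP; split=> [a _|c x y Bx By a Aa]; first by rewrite ip0r.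
  by rewrite ipDr ipZr Bx// By// mulr0 addr0.
pose Um := Subspace sB.
(* for y in B choose a in A with the same component as y in the positive
   subspace; then 0 = [a, y] bounds this component by the negative one *)
have [_ [be be0 beP]] : unif_neg_subspace B.
  apply/(unif_neg_subspaceP K0); split=> //; exists k; split=> // y By.
  rewrite neg_proj_compl; have [a Aa aE] := ontoA _ (pos_proj_idem K0 y).
  have := By a Aa; rewrite (form_decomp K0).
  have -> : pos_part K0 a = pos_part K0 y by apply: val_inj.
  move=> /eqP; rewrite subr_eq0 => /eqP e.
  have := kP _ Aa; rewrite pos_proj_compl aE !fund_norm_pos !fund_norm_neg => ka.
  have [->|/(ip_norm_gt0 (@pos_pos _ _ _ K0)) y0] := eqVneq (pos_part K0 y) 0.
    by rewrite ip_norm0 mulr_ge0 ?ip_norm_ge0.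
  rewrite -(ler_pM2r y0) -expr2 (sqr_ip_norm (@pos_pos _ _ _ K0)) ripE e -ripE.
  apply: le_trans (rip_le (@neg_pos _ _ _ K0) _ _) _.
  by rewrite mulrAC ler_wpM2r ?ip_norm_ge0.
have cB : ip_closed (fund_ip K0) (subspace_set Um).
  move=> y yc a Aa; suff e : f y a = f y 0 by rewrite ip_conj e ip0r rmorph0.
  apply: rip_inj => c; rewrite scaler0 rip0r.
  have le0 b : A b -> rip f y b <= 0.
    move=> Ab; apply/ler_addgt0Pr => e e0; rewrite add0r.
    have b1 : 0 < N0 b + 1 by rewrite ltr_wpDl ?ip_norm_ge0.
    have [z Bz] := yc _ (divr_gt0 e0 b1); rewrite ltr_pdivlMr// => /ltW; apply: le_trans.
    have -> : rip f y b = rip f (y - z) b.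
      by rewrite ripBl [X in _ - X]ripC [X in _ - X]ripE Bz// subr0.
    rewrite (le_trans (form_le K0 _ _))// ler_wpM2l ?ip_norm_ge0//.
    by rewrite lerDl.
  have [A0 AD] := (is_subspaceP A).1 sA.
  have Aca d : A (d *: a) by rewrite -[_ *: _]addr0; exact: AD.
  apply/eqP; rewrite eq_le le0//= -oppr_le0 -ripNr -scaleNr; exact: le0.
have hUm : is_hilbert (opp_form (sub_form f Um)).
  apply: (@sub_hilbert_equiv _ _ _ (opp_form f) Um be hilb cB be0) => x.
    by move=> /beP; rewrite ip_self -rmorphN lecR rip_opp.
  by rewrite rip_opp (le_trans (ler_norm _))// normrN ub.
have direct (xp : Up) (xm : Um) : val xp = val xm -> val xp = 0.
  move=> e; apply: contrapT => /eqP xp0.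
  have : 0 < f (val xp) (val xp).
    by apply: hUp.1; apply: contra_neq xp0 => ->; rewrite raddf0.
  by rewrite {2}e (subspace_val_in xm _ (subspace_val_in xp)) ltxx.
have span x : exists (xp : Up) (xm : Um), x = val xp + val xm.
  have [||xp xpP] := @riesz _ _ _ hUp (fun u => f (val u) x) (Num.sqrt al^-1 * N0 x).
  - by move=> a u v; rewrite linearP ipDl ipZl.
  - move=> u; rewrite -ripE (le_trans (form_le K0 _ _))// mulrAC.
    rewrite ler_wpM2r ?ip_norm_ge0//; apply: le_of_sqr_le; rewrite ?ip_norm_ge0//.
    by rewrite (sqr_ip_norm hUp.1); apply: lbp (subspace_val_in u).
  have /(@subspace_of_in _ _ Um)[xm xmE] : B (x - val xp).
    move=> a /(@subspace_of_in _ _ Up)[u <-].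
    by rewrite ipBr -xpP subrr.
  by exists xp, xm; rewrite xmE subrKC.
by exists (FundDecomp span direct
  (fun xp xm => subspace_val_in xm _ (subspace_val_in xp)) hUp hUm).
Qed.

End Krein.

(** * Sums over the vectors of a frame *)

Section Frames.
Variables (R : realType) (H : kreinType R) (I : choiceType) (fr : I -> H).
Local Notation f := (krein_form : {hform H}).
Local Notation N0 := (ip_norm (fund_ip (@krein_ref R H))).
Let K0 := @krein_ref R H.

Lemma sqr_absJ (z : R[i]) : sqr_abs (Num.conj z) = sqr_abs z.
Proof. by rewrite !sqr_absE Num.Theory.conjCK mulrC. Qed.

Lemma ell2P (c : I -> R[i]) : ell2 c <->
  exists b : R, forall A : {fset I}, \sum_(i <- A) sqr_abs (c i) <= b.
Proof. by apply: esum_fset_ltP => i; exact: sqr_abs_ge0. Qed.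

(** The Bessel bound for the Hilbert inner product transfers to the Krein form
    through the fundamental symmetry. *)
Lemma bessel_ell2 x : bessel_family fr -> ell2 (fun i => f x (fr i)).
Proof.
move=> [be bP]; apply/ell2P.
pose y := fund_sym K0 x.
exists (be * krein_norm y ^+ 2) => A.
have := bP y; move/esum_fset_leP => /(_ (fun i => sqr_abs_ge0 _))/(_ A).
apply: le_trans; rewrite le_eqVlt; apply/orP; left; apply/eqP.
apply: eq_bigr => i _; congr sqr_abs; rewrite ip_conj (form_fund K0).
by rewrite -[RHS]/((fund_ip K0 : {hform H}) y (fr i)) [RHS]ip_conj.
Qed.

Lemma form_sum_additive y x x' : rip f (x + x') y = rip f x y + rip f x' y.
Proof. exact: ripDl. Qed.

Lemma form_sum_bounded y x : rip f x y <= N0 y * N0 x.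
Proof. by rewrite mulrC; exact: form_le. Qed.

(** The product of the sum with x is the sum of the |[x, f_i]|^2. *)
Lemma frame_sum_ge0 (p : pred I) x s :
  has_sum_on (@krein_ip R H) p (fun i => f x (fr i) *: fr i) s ->
  0 <= rip f s x.
Proof.
move=> hs; have := has_sum_ge hs (form_sum_additive x) (form_sum_bounded x).
have t i : 0 <= rip f (if p i then f x (fr i) *: fr i else 0) x.
  case: ifP => _; last by rewrite rip0l.
  rewrite ripE ipZl (ip_conj f (fr i)) mulrC -sqr_absE; exact: sqr_abs_ge0.
by move=> /(_ t fset0); rewrite big_seq_fset0.
Qed.

(** The real part of c_i [f_i, x] is at most half of |c_i|^2 + |[x, f_i]|^2. *)
Lemma synthesis_bound (p : pred I) c : ell2 c -> exists C : R, forall x s y,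
  has_sum_on (@krein_ip R H) p (fun i => f x (fr i) *: fr i) s ->
  has_sum_on (@krein_ip R H) p (fun i => c i *: fr i) y ->
  rip f y x <= (C + rip f s x) / 2.
Proof.
move=> /ell2P[C CP]; exists C => x s y hs hy.
apply: (has_sum_le hy (form_sum_additive x) (form_sum_bounded x)) => A.
have := has_sum_ge hs (form_sum_additive x) (form_sum_bounded x).
have e i : rip f (if p i then f x (fr i) *: fr i else 0) x =
    if p i then sqr_abs (f x (fr i)) else 0.
  case: ifP => _; last by rewrite rip0l.
  by rewrite ripE ipZl (ip_conj f (fr i)) mulrC -sqr_absE.
have t i : 0 <= rip f (if p i then f x (fr i) *: fr i else 0) x.
  by rewrite e; case: ifP => // _; exact: sqr_abs_ge0.
move=> /(_ t A); under eq_bigr do rewrite e; move=> sle.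
rewrite (@le_trans _ _ (\sum_(i <- A) ((sqr_abs (c i) +
    (if p i then sqr_abs (f x (fr i)) else 0)) / 2)))//.
  apply: ler_sum => i _; case: ifP => _; last first.
    by rewrite rip0l addr0 divr_ge0// sqr_abs_ge0.
  rewrite ripE ipZl (le_trans (Re_mul_le _ _))// (ip_conj f (fr i)) sqr_absJ//.
by rewrite -mulr_suml big_split ler_wpM2r// lerD.
Qed.

Lemma synthesis_range_frame (p : pred I) j : p j -> synthesis_range fr p (fr j).
Proof.
move=> pj; exists (fun i => (i == j)%:R).
  apply/ell2P; exists 1 => A.
  have e i : sqr_abs ((i == j)%:R : R[i]) = if i == j then 1 else 0.
    by rewrite /sqr_abs -add_Re2_Im2; case: eqP => _ /=; rewrite ?expr1n ?expr0n ?addr0.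
  under eq_bigr do rewrite e.
  have [jA|jA] := boolP (j \in A).
    rewrite (big_fsetD1 j)//= eqxx big_seq big1 ?addr0// => i.
    by rewrite !inE => /andP[/negPf ->].
  rewrite big_seq big1// => i iA; case: eqP => // ij.
  by rewrite ij (negPf jA) in iA.
have := @has_sum_single R H I (fund_ip K0)
  (fun i => if p i then (i == j)%:R *: fr i else 0) j.
rewrite pj eqxx scale1r; apply => i /negPf ->.
by rewrite scale0r; case: (p i).
Qed.

End Frames.

(** * From a J-frame to the block form *)

Section Forward.
Variables (R : realType) (H : kreinType R).
Local Notation f := (krein_form : {hform H}).

Lemma pos_form_part (K : fund_decomp f) x (u : fd_pos K) :
  pos_form K (pos_part K x) u = f x (val u).
Proof. by rewrite (form_decomp K x) pos_part_val neg_part_pos ip0r subr0. Qed.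

Lemma neg_form_part (K : fund_decomp f) x (v : fd_neg K) :
  neg_form K (neg_part K x) v = - f x (val v).
Proof. by rewrite (form_decomp K x) neg_part_val pos_part_neg ip0r sub0r opprK. Qed.

Lemma pos_form_partr (K : fund_decomp f) x (u : fd_pos K) :
  pos_form K u (pos_part K x) = f (val u) x.
Proof. by rewrite ip_conj [RHS]ip_conj pos_form_part. Qed.

Lemma neg_form_partr (K : fund_decomp f) x (v : fd_neg K) :
  neg_form K v (neg_part K x) = - f (val v) x.
Proof. by rewrite ip_conj [f _ _]ip_conj neg_form_part rmorphN. Qed.

(** Maximality makes the projection of M to K_- surjective, and the uniform
    bound makes it injective; L is the K_+ component of its inverse. *)
Lemma graph_operator (K : fund_decomp f) (M : set H) :
  maximal_set (@unif_neg_subspace R H) M ->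
  exists (L : {linear fd_neg K -> fd_pos K}) (k : R),
  [/\ forall x, M x <-> pos_part K x = L (neg_part K x), 0 <= k, k < 1 &
      forall v, ip_norm (pos_form K) (L v) <= k * ip_norm (neg_form K) v].
Proof.
move=> [/(unif_neg_subspaceP K) Mg Mmax].
have Mgmax B : uniform_graph (fund_ip K) (neg_proj K) B -> M `<=` B -> B = M.
  by move=> /unif_neg_subspaceP; exact: Mmax.
have onto := maximal_graph_onto (fund_hilbert K) (neg_proj_idem K)
  (neg_proj_sa K) Mg Mgmax.
have [sM [k [k0 k1 kP]]] := Mg; have [M0 MD] := (is_subspaceP M).1 sM.
have kPQ x : M x ->
    ip_norm (pos_form K) (pos_part K x) <= k * ip_norm (neg_form K) (neg_part K x).
  by move=> /kP; rewrite neg_proj_compl fund_norm_pos fund_norm_neg.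
have Muniq (v : fd_neg K) (u u' : fd_pos K) :
    M (val u + val v) -> M (val u' + val v) -> u = u'.
  move=> Mu Mu'; have : M (val (u - u') + val (0 : fd_neg K)).
    have := MD (-1) _ _ Mu' Mu.
    by rewrite scaleN1r opprD addrACA addNr addr0 addrC !raddfB raddf0 addr0.
  move=> /kPQ; rewrite pos_partE neg_partE ip_norm0 mulr0 => uu.
  apply/eqP; rewrite -subr_eq0; apply/eqP/(ip_norm_eq0 (@pos_pos _ _ _ K)).
  by apply/eqP; rewrite eq_le uu ip_norm_ge0.
have Mpart x : M x -> M (val (pos_part K x) + val (neg_part K x)).
  by rewrite fund_decompK.
have [v||a v v' u u' Mu Mu'|L LP] :=
  @linear_of_rel _ (fd_neg K) (fd_pos K) (fun v u => M (val u + val v)).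
- have [|a Ma aE] := onto (val v); first by rewrite /= /neg_proj neg_part_val.
  exists (pos_part K a); have := Mpart _ Ma.
  by rewrite -[val (neg_part K a)]/(neg_proj K a) aE.
- exact: Muniq.
- have := MD a _ _ Mu Mu'.
  by rewrite !linearP scalerDr addrACA.
exists L, k; split=> // [x|v]; last by have := kPQ _ (LP v); rewrite pos_partE neg_partE.
split=> [/Mpart Mx|e]; last by rewrite -(fund_decompK K x) e; exact: LP.
exact: Muniq Mx (LP _).
Qed.

Variable S : {linear H -> H}.
Hypothesis S_bounded : bounded_op (@krein_ip R H) (@krein_ip R H) S.
Hypothesis S_self_adjoint : self_adjoint f S.

(** K_+ is the range of the positive synthesis operator and the range of the
    negative one is the graph of L. *)
Lemma block_of_J_frame_operator : J_frame_operator S ->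
  exists (K : fund_decomp f)
         (A' : {linear fd_pos K -> fd_pos K})
         (L : {linear fd_neg K -> fd_pos K})
         (Ls : {linear fd_pos K -> fd_neg K})
         (D' : {linear fd_neg K -> fd_neg K}),
    [/\ is_adjoint (neg_form K) (pos_form K) L Ls,
        block_op S A' (L \o D') (\- (D' \o Ls)) D',
        (bounded_op (pos_form K) (pos_form K) A' /\
         self_adjoint (pos_form K) A') /\
        uniformly_positive_op (pos_form K) (A' \+ (L \o D' \o Ls)),
        (op_norm (neg_form K) (pos_form K) L < 1)%E
      & uniformly_positive_op (neg_form K) D'].
Proof.
move=> [I [fr [[bes Mpmax Mmmax] frS]]].
have [K KE] := fund_decomp_of_maximal Mpmax.
have [L [k [LM k0 k1 Lk]]] := graph_operator K Mmmax.
have hp := fd_pos_hilbert K; have hn := fd_neg_hilbert K.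
have pp := @pos_pos _ _ _ K; have np := @neg_pos _ _ _ K.
have [Ls [Lsadj Lsk]] :=
  exists_adjoint (ipU := neg_form K) (ipV := pos_form K) hn pp k0 Lk.
pose Mp := synthesis_range fr (idx_pos fr).
pose Mm := synthesis_range fr (idx_neg fr).
have Mp_val x : Mp x -> exists u : fd_pos K, val u = x.
  by move=> Mx; apply: subspace_of_in; rewrite KE.
have val_Mp (u : fd_pos K) : Mp (val u).
  by have := subspace_val_in u; rewrite KE.
have coef x : ell2 (fun i => f x (fr i)) by exact: bessel_ell2.
pose A' : {linear fd_pos K -> fd_pos K} := pos_part K \o S \o val.
pose D' : {linear fd_neg K -> fd_neg K} := neg_part K \o S \o val.
(* The coefficients [x, f_i] are square summable, so both partial sums of S x
   lie in the ranges of the synthesis operators: yp in K_+ and ym in the graph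
   of L. *)
have split_S x : exists yp ym, [/\ 
    has_sum_on (@krein_ip R H) (idx_pos fr) (fun i => f x (fr i) *: fr i) yp,
    has_sum_on (@krein_ip R H) (idx_neg fr) (fun i => f x (fr i) *: fr i) ym,
    S x = yp - ym, val (pos_part K yp) = yp & pos_part K ym = L (neg_part K ym)].
  have [yp [ym [hyp hym e]]] := frS x; exists yp, ym; split=> //.
    have [|u <-] := Mp_val yp; last by rewrite pos_part_val.
    by exists (fun i => f x (fr i)).
  by apply/LM; exists (fun i => f x (fr i)).
have PS x yp ym : S x = yp - ym -> val (pos_part K yp) = yp ->
    pos_part K ym = L (neg_part K ym) ->
    pos_part K (S x) = pos_part K yp + L (neg_part K (S x)).
  move=> -> yE ymE; rewrite !raddfB /= ymE -yE neg_part_pos.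
  by rewrite pos_part_val raddf0 sub0r.
have yp0 v yp : has_sum_on (@krein_ip R H) (idx_pos fr)
    (fun i => f (val (v : fd_neg K)) (fr i) *: fr i) yp -> yp = 0.
  move=> hyp; have pos0 := @fund_pos _ _ _ (@krein_ref R H).
  apply: (@has_sum_kernel _ _ _ _ _ _ idfun 1 _ _ pos0 _ hyp) => [x|i].
    by rewrite mul1r.
  rewrite /=; case: ifP => // pi.
  have [u <-] := Mp_val _ (synthesis_range_frame fr pi).
  by rewrite ip_conj fd_orth rmorph0 scale0r.
have PSv v : pos_part K (S (val v)) = L (D' v).
  have [yp [ym [/yp0 yp0v _ e yE ymE]]] := split_S (val v).
  by rewrite (PS _ _ _ e yE ymE) yp0v raddf0 add0r.
have D'sa : self_adjoint (neg_form K) D'.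
  by move=> v v'; rewrite neg_form_part neg_form_partr S_self_adjoint.
have A'sa : self_adjoint (pos_form K) A'.
  by move=> u u'; rewrite pos_form_part pos_form_partr S_self_adjoint.
have QSu u : neg_part K (S (val u)) = - D' (Ls u).
  apply: (ip_eq np) => v; rewrite neg_form_partr -S_self_adjoint ipNr -D'sa.
  by rewrite -(Lsadj (D' v) u) -PSv pos_form_part.
have block : block_op S A' (L \o D') (\- (D' \o Ls)) D'.
  move=> u v; rewrite linearD -{1}(fund_decompK K (S (val u))).
  by rewrite -{1}(fund_decompK K (S (val v))) addrACA PSv QSu !raddfD.
pose T : {linear fd_pos K -> fd_pos K} := A' \+ (L \o D' \o Ls).
have TE u yp ym : S (val u) = yp - ym -> val (pos_part K yp) = yp ->
    pos_part K ym = L (neg_part K ym) -> T u = pos_part K yp.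
  move=> e yE ymE; rewrite /T /= (PS _ _ _ e yE ymE) QSu raddfN /=.
  by rewrite subrK.
have Tsa : self_adjoint (pos_form K) T.
  move=> u u'; rewrite [LHS]ipDl [RHS]ipDr A'sa; congr (_ + _).
  by rewrite [LHS]Lsadj D'sa [LHS]ip_conj [RHS]ip_conj [in RHS]Lsadj.
have bS : exists2 c : R, 0 <= c & forall x, ip_norm (fund_ip K) (S x) <=
    c * ip_norm (fund_ip K) x.
  have [c c0 cP] := (bounded_opP (fund_ip (@krein_ref R H))
    (@fund_pos _ _ _ (@krein_ref R H)) S).1 S_bounded.
  have [c1 c10 le1] := fund_norm_equiv (@krein_ref R H) K.
  have [c2 c20 le2] := fund_norm_equiv K (@krein_ref R H).
  exists (c2 * (c * c1)) => [|x]; first by rewrite !mulr_ge0 ?(ltW c10) ?(ltW c20).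
  rewrite -!mulrA (le_trans (le2 _))// ler_pM2l// (le_trans (cP _))//.
  by rewrite ler_wpM2l.
have [c c0 cS] := bS.
have A'b : forall u, ip_norm (pos_form K) (A' u) <= c * ip_norm (pos_form K) u.
  by move=> u; rewrite (le_trans (pos_part_le _ _))// (le_trans (cS _))// fund_norm_pos.
have D'b : forall v, ip_norm (neg_form K) (D' v) <= c * ip_norm (neg_form K) v.
  by move=> v; rewrite (le_trans (neg_part_le _ _))// (le_trans (cS _))// fund_norm_neg.
have Tb : bounded_op (pos_form K) (pos_form K) T.
  apply/(bounded_opP _ pp); exists (c + k * (c * k)).
    by rewrite addr_ge0 ?mulr_ge0.
  move=> u; rewrite mulrDl (le_trans (ip_normD pp _ _))//.
  apply: lerD; [exact: A'b|rewrite /=].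
  rewrite -!mulrA (le_trans (Lk _))// ler_wpM2l// (le_trans (D'b _))//.
  by rewrite ler_wpM2l// Lsk.
have TS u yp ym : S (val u) = yp - ym -> val (pos_part K yp) = yp ->
    pos_part K ym = L (neg_part K ym) ->
    rip (pos_form K) (T u) u = rip f yp (val u).
  by move=> e yE ymE; rewrite (TE _ _ _ e yE ymE) !ripE pos_form_part.
(* T is the restriction to K_+ of x |-> yp *)
have [|y|ca ca0 caP] := coercive_of_weak_bound (T := T) hp.
- move=> u; have [yp [ym [hyp _ e yE ymE]]] := split_S (val u).
  by rewrite (TS _ _ _ e yE ymE); exact: frame_sum_ge0 hyp.
- have [b bl hb] := val_Mp y; have [C CP] := synthesis_bound fr (idx_pos fr) bl.
  exists ((C + 1) / 2) => u; have [yp [ym [hyp _ e yE ymE]]] := split_S (val u).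
  rewrite (TS _ _ _ e yE ymE) => q1.
  rewrite ripC -[leLHS]/(rip f (val y) (val u)) (le_trans (CP _ _ _ hyp hb))//.
  by rewrite ler_wpM2r// lerD2l.
have DS v yp ym : has_sum_on (@krein_ip R H) (idx_pos fr)
    (fun i => f (val v) (fr i) *: fr i) yp -> S (val v) = yp - ym ->
    rip (neg_form K) (D' v) v = rip f ym (val v).
  by move=> /yp0 -> e; rewrite ripE neg_form_part e sub0r ipNl opprK.
have [|y|cd cd0 cdP] := coercive_of_weak_bound (T := D') hn.
- move=> v; have [yp [ym [hyp hym e yE ymE]]] := split_S (val v).
  by rewrite (DS _ _ _ hyp e); exact: frame_sum_ge0 hym.
(* f is - neg_form on K_-, whence the sign: - y lifts to the graph of L *)
- have Ma : Mm (val (L (- y)) + val (- y)) by apply/LM; rewrite pos_partE neg_partE.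
  have [b bl hb] := Ma; have [C CP] := synthesis_bound fr (idx_neg fr) bl.
  exists ((C + 1) / 2) => v; have [yp [ym [hyp hym e yE ymE]]] := split_S (val v).
  rewrite (DS _ _ _ hyp e) => q1.
  have -> : rip (neg_form K) v y = rip f (val (L (- y)) + val (- y)) (val v).
    have o : rip f (val (L (- y))) (val v) = 0 by rewrite ripE fd_orth.
    rewrite ripDl o add0r ripC raddfN ripNl.
    by rewrite rip_opp.
  rewrite (le_trans (CP _ _ _ hym hb))//.
  by rewrite ler_wpM2r// lerD2l.
exists K, A', L, Ls, D'; split=> //.
- split; first by split=> //; apply/(bounded_opP _ pp); exists c.
  exact: (coercive_uniformly_positive (T := T) hp Tsa Tb ca0 caP).
- by apply/(op_norm_lt1P _ np); exists k.
- apply: (coercive_uniformly_positive hn D'sa _ cd0 cdP).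
  by apply/(bounded_opP _ np); exists c.
Qed.

End Forward.

(** * From the block form to a J-frame *)

Section FormOfFunction.
Variables (R : realType) (V : lmodType R[i]) (g : V -> V -> R[i]).
Hypothesis g_linear : forall y (a : R[i]) x x',
  g (a *: x + x') y = a * g x y + g x' y.
Hypothesis g_conj : forall x y, g x y = Num.conj (g y x).

(** Linearity in the second argument follows from the Hermitian symmetry. *)
Lemma hform_of_function : exists h : {hform V}, forall x y, h x y = g x y.
Proof.
have bl : @bilinear_for R[i] V V R[i] *%R (Num.conj \; *%R) g.
  split=> [y a x x'|x a y y']; first exact: g_linear.
  by rewrite /= [LHS]g_conj g_linear rmorphD rmorphM [g x y]g_conj [g x y']g_conj.
have hm x y : g x y = (-1) ^+ false * Num.conj (g y x).
  by rewrite expr0 mul1r -g_conj.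
pose B := bilinear_isBilinear.Build R[i] V V R[i] *%R (Num.conj \; *%R) g bl.
pose C := isHermitianSesquilinear.Build R[i] V false Num.conj g hm.
pose h : {hform V} := HB.pack g B C.
by exists h.
Qed.
End FormOfFunction.

Section Converse.
Variables (R : realType) (H : kreinType R) (S : {linear H -> H}).
Local Notation f := (krein_form : {hform H}).
Variables (K : fund_decomp f)
  (A' : {linear fd_pos K -> fd_pos K}) (L : {linear fd_neg K -> fd_pos K})
  (Ls : {linear fd_pos K -> fd_neg K}) (D' : {linear fd_neg K -> fd_neg K}).
Hypothesis Ls_adj : is_adjoint (neg_form K) (pos_form K) L Ls.
Hypothesis S_block : block_op S A' (L \o D') (\- (D' \o Ls)) D'.
Hypothesis A_pos : uniformly_positive_op (pos_form K) (A' \+ (L \o D' \o Ls)).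
Hypothesis L_lt1 : (op_norm (neg_form K) (pos_form K) L < 1)%E.
Hypothesis D_pos : uniformly_positive_op (neg_form K) D'.
Let A : {linear fd_pos K -> fd_pos K} := A' \+ (L \o D' \o Ls).
Let pp := @pos_pos _ _ _ K.
Let np := @neg_pos _ _ _ K.

(* u x is the component of x in K_+ for the sum of K_+ and the graph of L, and
   neg_part K x is the parameter of the component in the graph. *)
Let u (x : H) := pos_part K x - L (neg_part K x).
Let w (x : H) := D' (Ls (pos_part K x) - neg_part K x).
Let T (x : H) := val (A (pos_part K x)) + (val (L (w x)) + val (w x)).

Let u_lin : linear u.
Proof.
move=> a x y; rewrite /u pos_part_linear neg_part_linear linearP.
by rewrite opprD scalerBr [LHS]addrACA.
Qed.

(** The projection onto K_+ along the graph of L. *)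
Definition graph_proj (x : H) : H := val (u x).
Let Pi := graph_proj.

Fact graph_proj_linear : linear graph_proj.
Proof. by move=> a x y; rewrite /graph_proj u_lin linearP. Qed.
HB.instance Definition _ :=
  GRing.isLinear.Build R[i] H H *:%R graph_proj graph_proj_linear.

Let u_val (p : fd_pos K) : u (val p) = p.
Proof. by rewrite /u pos_part_val neg_part_pos raddf0 subr0. Qed.

Let T_pos x : pos_part K (T x) = A (pos_part K x) + L (w x).
Proof. by rewrite /T addrA -raddfD pos_partE. Qed.
Let T_neg x : neg_part K (T x) = w x.
Proof. by rewrite /T addrA -raddfD neg_partE. Qed.
Let uT x : u (T x) = A (pos_part K x).
Proof. by rewrite /u T_pos T_neg addrK. Qed.

Let ST x : S x = Pi (T x) - (T x - Pi (T x)).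
Proof.
rewrite -{1}(fund_decompK K x) S_block /Pi /graph_proj uT /T.
rewrite [X in _ - (X - _)]addrC addrK.
rewrite [_ + (L \o D') _](_ : _ = A (pos_part K x) - L (w x)); last first.
  by rewrite /A /w /= !raddfB /= opprK addrA addrK.
rewrite (_ : (\- (D' \o Ls)) (pos_part K x) + D' (neg_part K x) = - w x); last first.
  by rewrite /w /= raddfB /= opprB addrC.
by rewrite raddfB raddfN opprD addrA.
Qed.

(** G is weighted by the inverses of A and D' so that its Gram operator T for
    the Krein form has the values required of the frame operator. Its norm
    dominates that of the fundamental decomposition by gram_norm_bound, and it
    is dominated since the inverses of A and D' are bounded. *)
Lemma graph_form : exists G : {hform H},
  [/\ is_hilbert G, self_adjoint G Pi, (forall x y, G (T x) y = f x y) &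
   exists c : R, 0 < c /\
     forall x, ip_norm (fund_ip K) x <= c * ip_norm G x /\
       ip_norm G x <= c * ip_norm (fund_ip K) x].
Proof.
have [_ Asa Apos [Ai [/(bounded_opP _ pp)[a a0 Aib] AK KA]]] := A_pos.
have [_ Dsa Dpos [Di [/(bounded_opP _ np)[d d0 Dib] DK KD]]] := D_pos.
have Ai_sa x y : pos_form K (Ai x) y = pos_form K x (Ai y).
  by rewrite -{2}(KA x) Asa KA.
have Di_sa x y : neg_form K (Di x) y = neg_form K x (Di y).
  by rewrite -{2}(KD x) Dsa KD.
have [|x y|G GE] := @hform_of_function _ H (fun x y =>
    pos_form K (Ai (u x)) (u y) + neg_form K (Di (neg_part K x)) (neg_part K y)).
- by move=> y b x x'; rewrite u_lin !linearP !ipDl !ipZl mulrDr addrACA.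
- by rewrite Ai_sa Di_sa rmorphD [in LHS]ip_conj [X in _ + X = _]ip_conj.
have GT x y : G (T x) y = f x y.
  rewrite GE uT T_neg AK DK (form_decomp K) /u ipBr ipBl.
  have -> : neg_form K (Ls (pos_part K x)) (neg_part K y) =
    pos_form K (pos_part K x) (L (neg_part K y)).
    by rewrite ip_conj [RHS]ip_conj Ls_adj.
  by rewrite addrA subrK.
have Ppos x : 0 <= rip (pos_form K) (Ai x) x.
  rewrite -{2}(KA x) ripC; have [->|/Apos] := eqVneq (Ai x) 0; first by rewrite rip0r.
  by rewrite ip_self_adjoint// ltcR => /ltW.
have Dpos' x : 0 <= rip (neg_form K) (Di x) x.
  rewrite -{2}(KD x) ripC; have [->|/Dpos] := eqVneq (Di x) 0; first by rewrite rip0r.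
  by rewrite ip_self_adjoint// ltcR => /ltW.
have rG x : rip G x x = rip (pos_form K) (Ai (u x)) (u x) +
    rip (neg_form K) (Di (neg_part K x)) (neg_part K x).
  by rewrite !ripE GE ReD.
have Gpos : definite_form G.
  move=> x x0; rewrite ip_self ltcR rG.
  have [q0|q0] := eqVneq (neg_part K x) 0; last first.
    apply: ltr_wpDl; first exact: Ppos.
    rewrite -{2}(KD (neg_part K x)) ripC -ltcR -ip_self_adjoint// Dpos//.
    by apply: contra_neq q0 => e; rewrite -(KD (neg_part K x)) e raddf0.
  rewrite q0 raddf0 rip0l addr0.
  have p0 : u x != 0.
    apply: contra_neq x0; rewrite /u q0 raddf0 subr0 => p0.
    by rewrite -(fund_decompK K x) p0 q0 !raddf0 addr0.
  rewrite -{2}(KA (u x)) ripC -ltcR -ip_self_adjoint// Apos//.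
  by apply: contra_neq p0 => e; rewrite -(KA (u x)) e raddf0.
have [c1 c10 le1] : exists2 c : R, 0 < c &
    forall x, ip_norm (fund_ip K) x <= c * ip_norm G x.
  apply: (gram_norm_bound (fund_hilbert K) (J := fun y => T (fund_sym K y))) => // x y.
  by rewrite [RHS]ip_conj GT [LHS]fund_form ip_conj.
have [k [k0 k1 Lk]] := (op_norm_lt1P _ np L).1 L_lt1.
have le2 x : ip_norm G x <= Num.sqrt (a * 4 + d) * ip_norm (fund_ip K) x.
  apply: (ip_norm_le Gpos); first by rewrite mulr_ge0 ?sqrtr_ge0 ?ip_norm_ge0.
  set N := ip_norm (fund_ip K) x.
  rewrite exprMn sqr_sqrtr; last by rewrite addr_ge0 ?mulr_ge0.
  rewrite rG mulrDl; apply: lerD.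
    apply: le_trans (rip_le pp _ _) _.
    have uN : ip_norm (pos_form K) (u x) <= 2 * N.
      rewrite (le_trans (ip_normBD pp _ _))// mulr_natl mulr2n lerD ?pos_part_le//.
      rewrite (le_trans (Lk _))// (le_trans _ (neg_part_le K x))//.
      by rewrite ler_piMl ?ip_norm_ge0// ltW.
    apply: (@le_trans _ _ (a * ip_norm (pos_form K) (u x) ^+ 2)).
      by rewrite expr2 mulrA ler_wpM2r ?ip_norm_ge0.
    rewrite -mulrA ler_wpM2l// (_ : 4 * N ^+ 2 = (2 * N) ^+ 2); last by ring.
    by rewrite ler_pXn2r ?nnegrE ?mulr_ge0 ?ip_norm_ge0.
  apply: le_trans (rip_le np _ _) _.
  apply: (@le_trans _ _ (d * ip_norm (neg_form K) (neg_part K x) ^+ 2)).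
    by rewrite expr2 mulrA ler_wpM2r ?ip_norm_ge0.
  by rewrite ler_wpM2l// ler_pXn2r ?nnegrE ?ip_norm_ge0// neg_part_le.
exists G; split=> //.
- exact: equivalent_hilbert (fund_hilbert K) Gpos le1 le2.
- move=> x y; rewrite !GE /Pi /graph_proj !u_val !neg_part_pos.
  by rewrite raddf0 ip0l ip0r.
- exists (c1 + Num.sqrt (a * 4 + d)); split; first by rewrite ltr_wpDr ?sqrtr_ge0.
  move=> x; split.
    rewrite (le_trans (le1 _))// ler_wpM2r ?ip_norm_ge0// lerDl sqrtr_ge0//.
  by rewrite (le_trans (le2 _))// ler_wpM2r ?ip_norm_ge0// lerDr ltW.
Qed.

Let Pi_idem x : Pi (Pi x) = Pi x.
Proof. by rewrite /Pi /graph_proj u_val. Qed.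

Let Pi_fixed_neg x : Pi x = x -> neg_part K x = 0.
Proof. by move=> <-; rewrite neg_part_pos. Qed.

Let Pi_zero_pos x : Pi x = 0 -> pos_part K x = L (neg_part K x).
Proof.
move=> e; have : val (u x) = val (0 : fd_pos K) by rewrite [LHS]e raddf0.
by move=> /val_inj/eqP; rewrite subr_eq0 => /eqP.
Qed.

Let Pi_fixed_form x : Pi x = x -> 0 <= rip f x x.
Proof.
by move=> /Pi_fixed_neg e; rewrite (form_norm_sqr K) e ip_norm0 expr0n subr0 sqr_ge0.
Qed.

Let Pi_zero_le : exists k : R, [/\ 0 <= k, k < 1 & forall x, Pi x = 0 ->
  ip_norm (pos_form K) (pos_part K x) <= k * ip_norm (neg_form K) (neg_part K x)].
Proof.
have [k [k0 k1 Lk]] := (op_norm_lt1P _ np L).1 L_lt1.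
by exists k; split=> // x /Pi_zero_pos ->.
Qed.

Let Pi_zero_form x : Pi x = 0 -> x != 0 -> rip f x x < 0.
Proof.
move=> e x0; have [k [k0 k1 /(_ x e) kx]] := Pi_zero_le.
have q0 : neg_part K x != 0.
  apply: contra_neq x0 => q0.
  by rewrite -(fund_decompK K x) (Pi_zero_pos e) q0 !raddf0 addr0.
rewrite (form_norm_sqr K) subr_lt0 ltr_pXn2r ?nnegrE ?ip_norm_ge0//.
by rewrite (le_lt_trans kx)// gtr_pMl// ip_norm_gt0.
Qed.

Let Pi_fixed_sub : is_subspace [set y | Pi y = y].
Proof.
apply/is_subspaceP; split=> [|a x y /= ex ey]; first exact: raddf0.
by rewrite /Pi linearP /= -/Pi ex ey.
Qed.

Let Pi_zero_sub : is_subspace [set y | Pi y = 0].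
Proof.
apply/is_subspaceP; split=> [|a x y /= ex ey]; first exact: raddf0.
by rewrite /Pi linearP /= -/Pi ex ey scaler0 addr0.
Qed.

Let Pi_fixed_max : maximal_set (@unif_pos_subspace R H) [set y | Pi y = y].
Proof.
split.
  apply/(unif_pos_subspaceP K); split; first exact: Pi_fixed_sub.
  exists 0; split=> // x /= ex.
  rewrite pos_proj_compl /neg_proj (Pi_fixed_neg ex) raddf0 ip_norm0.
  by rewrite mul0r.
move=> B [sB [al al0 alP]] CB; have [B0 BD] := (is_subspaceP B).1 sB.
apply/seteqP; split=> // b Bb /=; apply/esym/eqP; rewrite -subr_eq0.
have Bw : B (b - Pi b).
  by rewrite addrC -scaleN1r; apply: BD => //; apply: CB; exact: Pi_idem.
have Pw : Pi (b - Pi b) = 0 by rewrite /Pi raddfB /= -/Pi Pi_idem subrr.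
apply: contraT => /(Pi_zero_form Pw); rewrite ltNge => /negP[].
have := alP _ Bw; rewrite ip_self lecR; apply: le_trans.
by rewrite mulr_ge0 ?sqr_ge0// ltW.
Qed.

Let Pi_zero_max : maximal_set (@unif_neg_subspace R H) [set y | Pi y = 0].
Proof.
split.
  have [k [k0 k1 kP]] := Pi_zero_le.
  apply/(unif_neg_subspaceP K); split; first exact: Pi_zero_sub.
  exists k; split=> // x /= ex.
  by rewrite neg_proj_compl fund_norm_pos fund_norm_neg kP.
move=> B [sB [al al0 alP]] CB; have [B0 BD] := (is_subspaceP B).1 sB.
apply/seteqP; split=> // b Bb /=.
have Bw : B (Pi b).
  have := BD (-1) (b - Pi b) b; rewrite scaleN1r (opprB b (Pi b)) subrK; apply=> //.
  by apply: CB; rewrite /= /Pi raddfB /= -/Pi Pi_idem subrr.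
apply/eqP; apply: contraT => w0.
have := alP _ Bw; rewrite ip_self -rmorphN lecR.
have : 0 < al * krein_norm (Pi b) ^+ 2.
  by rewrite mulr_gt0// exprn_gt0// ip_norm_gt0//; exact: fund_pos.
by have := Pi_fixed_form (Pi_idem b); lra.
Qed.

(** The frame is a G-orthonormal basis of eigenvectors of the projection onto
    K_+ along the graph of L. The basis vectors in K_+ have index in I_+, those
    in the graph have index in I_-, and the two synthesis ranges are the range
    and the kernel of this projection. *)
Theorem J_frame_operator_of_block : J_frame_operator S.
Proof.
have [G [hG Pi_sa GT [c [c0 cP]]]] := graph_form.
have posG : definite_form G := hG.1.
pose K0 := @krein_ref R H.
have [c1 c10 le1] := fund_norm_equiv K0 K.
have [c2 c20 le2] := fund_norm_equiv K K0.
have N0G x : ip_norm (fund_ip K0) x <= c1 * c * ip_norm G x.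
  by rewrite -mulrA (le_trans (le1 _))// ler_pM2l//; have [] := cP x.
have GN0 x : ip_norm G x <= c * c2 * ip_norm (fund_ip K0) x.
  have [_] := cP x; move/le_trans; apply.
  by rewrite -mulrA ler_pM2l.
have [E [E_on E_Pi0 E_sum]] := orthonormal_basis hG Pi_idem Pi_sa.
have E_Pi e : E e -> Pi e = e \/ Pi e = 0 by exact: E_Pi0.
(* The family is indexed by H itself and vanishes off E. *)
pose fr (e : H) : H := if e \in E then e else 0.
have frE e : E e -> fr e = e by move=> Ee; rewrite /fr mem_set.
have fr0 e : ~ E e -> fr e = 0 by move=> Ee; rewrite /fr memNset.
have E_neq0 e : E e -> e != 0.
  move=> Ee; apply/eqP => e0; have := E_on e e Ee Ee.
  by rewrite e0 ip0l eqxx => /eqP; rewrite eq_sym oner_eq0.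
have pos_out e : ~ E e -> idx_pos fr e by move=> nE; rewrite /idx_pos fr0// ip0l.
have pos_fixed e : E e -> Pi e = e -> idx_pos fr e.
  move=> Ee /Pi_fixed_form; rewrite /idx_pos frE// ip_self.
  by rewrite -lecR.
have neg_zero e : E e -> Pi e = 0 -> idx_neg fr e.
  move=> Ee /Pi_zero_form/(_ (E_neq0 e Ee)); rewrite /idx_neg frE// ip_self.
  by rewrite -ltcR.
have negN e : idx_pos fr e -> idx_neg fr e = false.
  by rewrite /idx_pos /idx_neg; apply: le_gtF.
have posN e : idx_neg fr e -> idx_pos fr e = false.
  by rewrite /idx_pos /idx_neg; apply: lt_geF.
have pos_term z e : (if idx_pos fr e then G z (fr e) *: fr e else 0) =
    fourier G E (Pi z) e.
  have [Ee|nE] := pselect (E e); last first.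
    by rewrite fourier_out// fr0// scaler0 if_same.
  rewrite fourier_in// Pi_sa frE//.
  have [Pe|Pe] := E_Pi _ Ee; first by rewrite pos_fixed//= Pe.
  by rewrite posN ?neg_zero//= Pe ip0r scale0r.
have neg_term z e : (if idx_neg fr e then G z (fr e) *: fr e else 0) =
    fourier G E (z - Pi z) e.
  have [Ee|nE] := pselect (E e); last first.
    by rewrite fourier_out// fr0// scaler0 if_same.
  rewrite fourier_in// ipBl Pi_sa frE//.
  have [Pe|Pe] := E_Pi _ Ee; last by rewrite neg_zero//= Pe ip0r subr0.
  by rewrite negN ?pos_fixed//= Pe subrr scale0r.
have sum_pos z : has_sum_on (@krein_ip R H) (idx_pos fr)
    (fun e => G z (fr e) *: fr e) (Pi z).
  have -> : has_sum_on (@krein_ip R H) (idx_pos fr) (fun e => G z (fr e) *: fr e)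
      = has_sum (@krein_ip R H) (fourier G E (Pi z)).
    by congr has_sum; apply/funext => e; exact: pos_term.
  exact: (has_sum_equiv N0G (E_sum (Pi z))).
have sum_neg z : has_sum_on (@krein_ip R H) (idx_neg fr)
    (fun e => G z (fr e) *: fr e) (z - Pi z).
  have -> : has_sum_on (@krein_ip R H) (idx_neg fr) (fun e => G z (fr e) *: fr e)
      = has_sum (@krein_ip R H) (fourier G E (z - Pi z)).
    by congr has_sum; apply/funext => e; exact: neg_term.
  exact: (has_sum_equiv N0G (E_sum (z - Pi z))).
have bessel z (B : {fset H}) : \sum_(e <- B) sqr_abs (G z (fr e)) <= ip_norm G z ^+ 2.
  have := bessel_inequality hG E_on B z; apply: le_trans.
  rewrite le_eqVlt; apply/orP; left; apply/eqP; apply: eq_bigr => e _.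
  rewrite /fr; case: ifP => // _.
  by rewrite ip0r /sqr_abs normr0 expr0n.
have coef z : ell2 (fun e => G z (fr e)).
  by apply/ell2P; exists (ip_norm G z ^+ 2); exact: bessel.
have range_pos : synthesis_range fr (idx_pos fr) = [set y | Pi y = y].
  apply/seteqP; split=> [y [x _ xs]|y /= ey]; last first.
    by exists (fun e => G y (fr e)) => //; rewrite -{2}ey.
  have := @has_sum_kernel _ _ _ _ _ _ (idfun \- graph_proj) 1 _ _ posG _
    (has_sum_equiv GN0 xs).
  move=> h; apply/esym/eqP; rewrite -subr_eq0; apply/eqP; apply: h => [z|e].
    by rewrite mul1r; exact: (projection_compl_le hG Pi_idem Pi_sa).
  rewrite /=; case: ifP => [pe|_]; last by rewrite raddf0 subrr.
  have [Ee|nE] := pselect (E e); last by rewrite fr0// scaler0 raddf0 subrr.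
  rewrite frE// linearZ /= -/(Pi e); have [->|/(neg_zero _ Ee)] := E_Pi _ Ee.
    by rewrite subrr.
  by move/posN; rewrite pe.
have range_neg : synthesis_range fr (idx_neg fr) = [set y | Pi y = 0].
  apply/seteqP; split=> [y [x _ xs]|y /= ey]; last first.
    by exists (fun e => G y (fr e)) => //; have := sum_neg y; rewrite ey subr0.
  apply: (@has_sum_kernel _ _ _ _ _ _ graph_proj 1 _ _ posG _
    (has_sum_equiv GN0 xs)) => [z|e].
    by rewrite mul1r; exact: (projection_le hG Pi_idem Pi_sa).
  case: ifP => [ne|_]; last by rewrite raddf0.
  have [Ee|nE] := pselect (E e); last by rewrite fr0// scaler0 raddf0.
  rewrite frE// linearZ /= -/(Pi e); have [/(pos_fixed _ Ee)|->] := E_Pi _ Ee.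
    by move/negN; rewrite ne.
  by rewrite scaler0.
have GT_le x : ip_norm G (T x) <= c1 * c * ip_norm (fund_ip K0) x.
  have [->|/(ip_norm_gt0 posG) Tx0] := eqVneq (T x) 0.
    by rewrite ip_norm0 mulr_ge0 ?ip_norm_ge0// mulr_ge0 ?ltW.
  rewrite -(ler_pM2r Tx0) -expr2 (sqr_ip_norm posG) ripE GT -ripE.
  rewrite (le_trans (form_le K0 _ _))// mulrAC mulrC.
  by rewrite ler_wpM2r ?ip_norm_ge0.
exists H, fr; split.
  split; last 2 first.
  - by rewrite range_pos; exact: Pi_fixed_max.
  - by rewrite range_neg; exact: Pi_zero_max.
  exists ((c1 * c) ^+ 2) => x; apply/esum_fset_leP => [i|B]; first exact: sqr_abs_ge0.
  have e i : krein_ip x (fr i) = G (T (fund_sym K0 x)) (fr i).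
    rewrite GT ip_conj -[LHS]/((fund_ip K0 : {hform H}) x (fr i)) ip_conj.
    by congr Num.conj; exact: fund_form.
  under eq_bigr do rewrite e.
  rewrite (le_trans (bessel _ _))// -exprMn.
  rewrite ler_pXn2r ?nnegrE ?mulr_ge0 ?ip_norm_ge0 ?(ltW c10) ?(ltW c0)//.
  by rewrite (le_trans (GT_le _))// fund_norm_sym.
move=> x; have eT : (fun e => f x (fr e) *: fr e) = (fun e => G (T x) (fr e) *: fr e).
  by apply/funext => e; rewrite GT.
exists (Pi (T x)), (T x - Pi (T x)); rewrite eT; split; last exact: ST.
- exact: sum_pos.
- exact: sum_neg.
Qed.

End Converse.

Theorem theorem3p2 (R : realType) (H : kreinType R) (S : {linear H -> H})
  (S_bounded : bounded_op (@krein_ip R H) (@krein_ip R H) S)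
  (S_self_adjoint : self_adjoint krein_form S) :
  J_frame_operator S <->
  exists (K : fund_decomp (krein_form : {hform H}))
         (A' : {linear fd_pos K -> fd_pos K})
         (L : {linear fd_neg K -> fd_pos K})
         (Ls : {linear fd_pos K -> fd_neg K})
         (D' : {linear fd_neg K -> fd_neg K}),
    [/\ is_adjoint (neg_form K) (pos_form K) L Ls,
        block_op S A' (L \o D') (\- (D' \o Ls)) D',
        (bounded_op (pos_form K) (pos_form K) A' /\
         self_adjoint (pos_form K) A') /\
        uniformly_positive_op (pos_form K) (A' \+ (L \o D' \o Ls)),
        (op_norm (neg_form K) (pos_form K) L < 1)%E
      & uniformly_positive_op (neg_form K) D'].
Proof.
split; first exact: block_of_J_frame_operator.
case=> K [A' [L [Ls [D' [Ls_adj S_block [_ A_pos] L_lt1 D_pos]]]]].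
exact: J_frame_operator_of_block Ls_adj S_block A_pos L_lt1 D_pos.
Qed.
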